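(* Let $t\in(-1,1)$, $0<|q|<1$, and let $a,b\in\mathbb C$, $b\neq0$, be such that no denominator factor below vanishes. Then $${}_2\phi_1\left(\begin{array}{c}a,\ b\\ qab^{-1}\end{array};q,qt^2\right)=\frac{\left(q(at)^2,\ qab^{-1}t,\ qt;q\right)_\infty}{\left(qa^2b^{-1}t,\ qat,\ qt^2;q\right)_\infty}\;{}_8\phi_7\left(\begin{array}{c}a^2b^{-1}t,\ \pm qab^{-\frac12}t^{\frac12},\ \pm q^{\frac12}ab^{-1},\ -ab^{-1},\ bt,\ a\\ \pm ab^{-\frac12}t^{\frac12},\ \pm q^{\frac12}at,\ qa^2b^{-2},\ qab^{-1}t,\ -qat\end{array};q,qt\right),$$ and this identity remains valid under the replacement $t\mapsto -t$.
   Context: In a list of parameters, $\pm c$ stands for the two entries $c,-c$ (the same choice of square root is used wherever it appears). $q$-Pochhammer symbols: $(a;q)_0=1$, $(a;q)_n=(1-a)(1-aq)\cdots(1-aq^{n-1})$, $(a;q)_\infty=\prod_{n\ge0}(1-aq^n)$, and $(a_1,\ldots,a_r;q)_n=(a_1;q)_n\cdots(a_r;q)_n$ (also for $n=\infty$). Basic hypergeometric series: ${}_r\phi_s\left(\begin{array}{c}a_1,\ldots,a_r\\ b_1,\ldots,b_s\end{array};q,z\right)=\sum_{k=0}^\infty\frac{(a_1,\ldots,a_r;q)_k}{(q,b_1,\ldots,b_s;q)_k}\left((-1)^kq^{\binom k2}\right)^{1+s-r}z^k$. *)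

(* Defs.v *)
From HB Require Import structures.
From mathcomp Require Import all_boot all_order all_algebra.
From mathcomp Require Import complex.
From mathcomp Require Import all_classical all_reals all_analysis.

Set Implicit Arguments.
Unset Strict Implicit.
Unset Printing Implicit Defensive.

Import Order.TTheory GRing.Theory Num.Theory numFieldNormedType.Exports.
Local Open Scope classical_set_scope.
Local Open Scope ring_scope.

Definition qpoch (C : numFieldType) (q a : C) (n : nat) : C :=
  \prod_(i < n) (1 - a * q ^+ i).

Definition qpoch_inf (C : numFieldType) (q a : C) : C :=
  limn (qpoch q a).

Definition qpochs (C : numFieldType) (q : C) (s : seq C) (n : nat) : C :=
  \prod_(a <- s) qpoch q a n.

Definition qpochs_inf (C : numFieldType) (q : C) (s : seq C) : C :=
  \prod_(a <- s) qpoch_inf q a.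

(* The exponent 1 + s - r, with r and s the lengths of the parameter lists, is
   taken in int and may be negative. *)
Definition qhyp_term (C : numFieldType) (upper lower : seq C) (q z : C)
    (k : nat) : C :=
  qpochs q upper k / qpochs q (q :: lower) k
  * ((-1) ^+ k * q ^+ 'C(k, 2)) ^ (1 + (size lower)%:Z - (size upper)%:Z)
  * z ^+ k.

Definition qhyp (C : numFieldType) (upper lower : seq C) (q z : C) : C :=
  limn (series (qhyp_term upper lower q z)).

(* No factor 1 - c q^n of (c; q)_m, m finite or infinite, is zero, for any c in
   the list s. *)
Definition qfactors_neq0 (C : numFieldType) (q : C) (s : seq C) : Prop :=
  forall c, c \in s -> forall n : nat, 1 - c * q ^+ n != 0.

Definition lhs_lower (C : numFieldType) (q a b : C) : seq C :=
  [:: q * a * b^-1].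

Definition prefactor_num (C : numFieldType) (q a b t : C) : seq C :=
  [:: q * (a * t) ^+ 2; q * a * b^-1 * t; q * t].

Definition prefactor_den (C : numFieldType) (q a b t : C) : seq C :=
  [:: q * a ^+ 2 * b^-1 * t; q * a * t; q * t ^+ 2].

(* sq, sb and st stand for the chosen square roots of q, b and t. *)
Definition rhs_upper (C : numFieldType) (q a b t sq sb st : C) : seq C :=
  [:: a ^+ 2 * b^-1 * t;
      q * a * sb^-1 * st; - (q * a * sb^-1 * st);
      sq * a * b^-1; - (sq * a * b^-1);
      - (a * b^-1); b * t; a].

Definition rhs_lower (C : numFieldType) (q a b t sq sb st : C) : seq C :=
  [:: a * sb^-1 * st; - (a * sb^-1 * st);
      sq * a * t; - (sq * a * t);
      q * a ^+ 2 * b^-2; q * a * b^-1 * t; - (q * a * t)].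

Definition denominators_neq0 (C : numFieldType) (q a b t sq sb st : C) : Prop :=
  qfactors_neq0 q (q :: lhs_lower q a b) /\
  qfactors_neq0 q (prefactor_den q a b t) /\
  qfactors_neq0 q (q :: rhs_lower q a b t sq sb st).

Definition quadratic_identity (C : numFieldType) (q a b t sq sb st : C) : Prop :=
  qhyp [:: a; b] (lhs_lower q a b) q (q * t ^+ 2) =
  qpochs_inf q (prefactor_num q a b t) / qpochs_inf q (prefactor_den q a b t)
  * qhyp (rhs_upper q a b t sq sb st) (rhs_lower q a b t sq sb st) q (q * t).

(* Main.v *)
(** Write a = b c. Both sides, as functions u(b, c, t), satisfy the same two
contiguous relations: one between u(b, c, t), u(b, c q, t), u(b, c q^2, t), and
one between u(b, c, t), u(b, c q, t), u(b/q, c q, t q). Each is proved term by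
term, by telescoping. As n grows, both sides at (b, c q^n, t) tend to
(b q t^2; q)_oo / (q t^2; q)_oo: the limiting series are summed by the
q-binomial theorem. At c = 0 the first relation has characteristic roots 1 and
1 / (b t^2), so when |b t^2| < 1 the difference of the two sides, which tends to
0 along c q^n, vanishes identically. The second relation replaces b t^2 by
b t^2 q, and removes this restriction by induction. *)

Require Import Defs.
From HB Require Import structures.
From mathcomp Require Import all_boot all_order all_algebra.
From mathcomp Require Import complex ring.
From mathcomp Require Import all_classical all_reals all_analysis.

Import Order.TTheory GRing.Theory Num.Theory numFieldNormedType.Exports.
Local Open Scope classical_set_scope.
Local Open Scope ring_scope.
Local Open Scope complex_scope.

(** The bound |b t^2| < 1 is forced by the first relation: for |b t^2| > 1 the limiting recurrence
    has the solution (b t^2)^(-n), which tends to 0, so vanishing in the limit cannot exclude a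
    nonzero difference. The second relation escapes this: once its third term vanishes by induction
    it is of first order in c, and iterating it produces convergent infinite products. The variables
    b and c are chosen for these shifts: along c q^n the parameter a = b c tends to 0 with b fixed,
    while the second shift keeps both b c and b t. Each relation between summands becomes an
    identity of rational functions once all its symbols are reduced to common ones. The analysis
    consists of bounds by geometric series, uniform in the shift c q^n. *)

(** * Convergence of geometrically dominated complex series *)

Lemma norm_complex_real (R : realType) (z : R[i]) :
  exists2 r : R, 0 <= r & `|z| = r%:C.
Proof. exists (complex.Re `|z|); rewrite normc_def //=; exact: sqrtr_ge0. Qed.

Lemma ler_norm_ReIm (R : realType) (z : R[i]) :
  `|z| <= (`|complex.Re z| + `|complex.Im z|)%:C.
Proof.
rewrite normc_def lecR -[leRHS]ger0_norm; last exact: addr_ge0.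
rewrite -sqrtr_sqr ler_wsqrtr // sqrrD !real_normK ?num_real //.
by rewrite addrAC lerDl mulrn_wge0 // mulr_ge0.
Qed.

Lemma is_cvgn_dist (C : numFieldType) (u : nat -> C) (l : C) :
  (forall e, 0 < e -> exists N, forall n, (N <= n)%N -> `|l - u n| < e) ->
  cvgn u.
Proof.
move=> H; apply: (cvgP l); apply/cvgrPdist_lt => e /H[N HN].
by exists N => // n /= /HN.
Qed.

(* The only form of completeness that the proof needs; it lets the analysis be
   done over an abstract numFieldType. *)
Definition geo_complete (C : numFieldType) : Prop :=
  forall (f : nat -> C) (M r : C), 0 <= r -> r < 1 ->
    (forall k, `|f k| <= M * r ^+ k) -> cvgn (series f).

(** Real and imaginary parts are dominated by a real geometric series, so they converge in [R], and
    the complex limit is assembled from them. Norms in [R[i]] are themselves complex, so the bounds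
    are first moved to [R]. *)
Lemma complex_geo_complete (R : realType) : geo_complete R[i].
Proof.
move=> f M r r0 r1 fM.
have [s s0 sE] := @norm_complex_real R r; rewrite (ger0_norm r0) in sE.
have [m m0 mE] := @norm_complex_real R M.
have mf k : `|f k| <= (m * s ^+ k)%:C.
  have -> : (m * s ^+ k)%:C = `|M| * r ^+ k by rewrite sE mE rmorphM rmorphXn.
  apply: le_trans (fM k) _; apply: ler_wpM2r; first exact: exprn_ge0.
  (* The bound at k = 0 makes M nonnegative, hence real and at most its norm. *)
  apply: real_ler_norm; have := fM 0%N.
  by rewrite expr0 mulr1 => /(le_trans (normr_ge0 _)); exact: ger0_real.
have s1 : `|s| < 1.
  by move: r1; rewrite sE -(rmorph1 (@real_complex R)) ltcR ger0_norm.
have cg := is_cvg_geometric_series (a := m) s1.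
have cR (P : R[i] -> R) : (forall z, (`|P z|)%:C <= `|z|) ->
    cvgn (series (P \o f)).
  move=> HP; apply: normed_cvg; apply: series_le_cvg cg.
  - by move=> n /=.
  - by move=> n; rewrite /geometric /= mulr_ge0 // exprn_ge0.
  - by move=> n /=; rewrite -lecR; apply: le_trans (mf n); apply: HP.
have /cvg_ex[x /= Hx] := cR _ (fun z => normc_ge_Re z).
have [y Hy] : exists y : R, series (@complex.Im R \o f) @ \oo --> y.
  apply/cvg_ex; apply: cR => z; case: z => a b; rewrite normc_def /= lecR.
  by rewrite -sqrtr_sqr ler_wsqrtr // lerDr sqr_ge0.
apply: (@is_cvgn_dist _ _ (x +i* y)) => e e0.
have [d d0 ->] : exists2 d : R, 0 < d & e = d%:C.
  move: e0; rewrite ltcE => /andP[/eqP ie re]; exists (complex.Re e) => //.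
  by apply/eqP; rewrite eq_complex ie /= !eqxx.
have d20 : 0 < d / 2 by rewrite divr_gt0.
move/cvgrPdist_lt : Hx => /(_ _ d20) [N1 _ H1].
move/cvgrPdist_lt : Hy => /(_ _ d20) [N2 _ H2].
exists (maxn N1 N2) => n; rewrite geq_max => /andP[n1 n2].
apply: le_lt_trans (ler_norm_ReIm _ _) _; rewrite ltcR [ltRHS]splitr.
have := ltrD (H1 n n1) (H2 n n2); congr (_ < _).
by rewrite !raddfB /= /series /= !raddf_sum.
Qed.

Lemma cvg_dist_le (C : numFieldType) (u : nat -> C) (l y K : C) (m : nat) :
  u @ \oo --> l -> (forall n, (m <= n)%N -> `|u n - y| <= K) -> `|l - y| <= K.
Proof.
move=> ul uK; apply/ler_addgt0Pr => e e0.
move/cvgrPdist_lt : ul => /(_ e e0) [N _ /(_ (maxn m N) (leq_maxr _ _)) H].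
rewrite -(subrK (u (maxn m N)) l) -addrA addrC; apply: le_trans (ler_normD _ _) _.
by apply: lerD; [exact/uK/leq_maxl | exact: ltW].
Qed.

Lemma cvg_geo0 (C : numFieldType) (hC : geo_complete C) (z : C) :
  `|z| < 1 -> (fun n => z ^+ n) @ \oo --> 0.
Proof.
move=> z1; apply: cvg_series_cvg_0.
apply: (hC _ 1 `|z|) => // k; by rewrite normrX mul1r.
Qed.

(** * Uniform bounds and limits of q-Pochhammer symbols *)

Lemma qpoch0 (C : numFieldType) (q x : C) : qpoch q x 0 = 1.
Proof. by rewrite /qpoch big_ord0. Qed.

Lemma qpochSr (C : numFieldType) (q x : C) n :
  qpoch q x n.+1 = qpoch q x n * (1 - x * q ^+ n).
Proof. by rewrite /qpoch big_ord_recr. Qed.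

Lemma qpochSl (C : numFieldType) (q x : C) n :
  qpoch q x n.+1 = (1 - x) * qpoch q (x * q) n.
Proof.
rewrite /qpoch big_ord_recl expr0 mulr1; congr (_ * _).
by apply: eq_bigr => i _; rewrite /= exprS mulrA.
Qed.

Lemma qpochD (C : numFieldType) (q x : C) m n :
  qpoch q x (m + n) = qpoch q x m * qpoch q (x * q ^+ m) n.
Proof.
elim: n => [|n IH]; first by rewrite addn0 qpoch0 mulr1.
by rewrite addnS !qpochSr IH mulrA -[x * _ * _]mulrA -exprD.
Qed.

(** The condition 2 y <= 1 - r keeps the right-hand side at most 2, so each new factor adds at most
    2 y r^n, and these increments sum to the stated bound. No exponential is involved. *)
Lemma prod_geo_le (C : numFieldType) (r y : C) n :
  0 <= r -> r < 1 -> 0 <= y -> 2 * y <= 1 - r ->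
  \prod_(i < n) (1 + y * r ^+ i) <= 1 + 2 * y * (1 - r ^+ n) / (1 - r).
Proof.
move=> r0 r1 y0 yr.
have r10 : 0 < 1 - r by rewrite subr_gt0.
elim: n => [|n IH]; first by rewrite big_ord0 expr0 subrr mulr0 mul0r addr0.
have yn0 : 0 <= y * r ^+ n by rewrite mulr_ge0 ?exprn_ge0.
rewrite big_ord_recr /=; apply: le_trans (_ : (1
  + 2 * y * (1 - r ^+ n) / (1 - r)) * (1 + y * r ^+ n) <= _).
  by apply: ler_wpM2r => //; rewrite addr_ge0.
have s1 : 2 * y * (1 - r ^+ n) / (1 - r) <= 1.
  rewrite ler_pdivrMr // mul1r; apply: le_trans yr.
  by rewrite ler_piMr ?mulr_ge0 // gerBl exprn_ge0.
rewrite mulrDr mulr1.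
have -> : 1 + 2 * y * (1 - r ^+ n.+1) / (1 - r) =
  1 + 2 * y * (1 - r ^+ n) / (1 - r) + 2 * (y * r ^+ n).
  by rewrite exprS; field; rewrite gt_eqF.
by apply: lerD => //; apply: ler_wpM2r => //; rewrite -[2]/(1 + 1) lerD2l.
Qed.

Lemma qpoch_bounded (C : numFieldType) (hC : geo_complete C) (q B : C) :
  `|q| < 1 -> 0 <= B -> exists2 K : C, 0 <= K &
  forall x n, `|x| <= B -> `|qpoch q x n| <= K.
Proof.
move=> q1 B0; have q10 : 0 < 1 - `|q| by rewrite subr_gt0.
(* The index m is where [prod_geo_le] starts to apply, with y = B |q|^m; B + 1 avoids a division by
   0. *)
have /cvgr0Pnorm_lt/(_ ((1 - `|q|) / (2 * (B + 1)))) : (fun n =>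
  `|q| ^+ n) @ \oo --> 0.
  by apply: cvg_geo0 => //; rewrite normr_id.
have B1 : 0 < B + 1 by rewrite ltr_wpDl.
have e0 : 0 < (1 - `|q|) / (2 * (B + 1)) by rewrite divr_gt0 // mulr_gt0.
move=> /(_ e0) [m _ /(_ m (leqnn m)) /=]; rewrite normrX normr_id => qm.
have Bm : 2 * (B * `|q| ^+ m) <= 1 - `|q|.
  move/ltW : qm; rewrite ler_pdivlMr ?mulr_gt0 // => qm.
  apply: le_trans qm; rewrite mulrA mulrC.
  apply: ler_wpM2l; first exact: exprn_ge0.
  by rewrite ler_pM2l // lerDl.
have fac_ge0 i : 0 <= 1 + B * `|q| ^+ i by rewrite addr_ge0 // mulr_ge0 ?exprn_ge0.
exists ((\prod_(i < m) (1 + B * `|q| ^+ i)) * 2).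
  by rewrite mulr_ge0 // prodr_ge0.
move=> x n xB.
have H : forall k, `|qpoch q x k| <= \prod_(i < k) (1 + B * `|q| ^+ i).
  move=> k; rewrite /qpoch normr_prod; apply: ler_prod => i _; rewrite normr_ge0 /=.
  apply: le_trans (ler_normB _ _) _; rewrite normr1 lerD2l normrM normrX.
  by rewrite ler_wpM2r // exprn_ge0.
apply: le_trans (H n) _.
(* All bounding factors are at least 1, so n may be enlarged to m + n, which splits at m whatever n
   is. *)
have : \prod_(i < n) (1 + B * `|q| ^+ i) <= \prod_(i < m + n) (1 + B * `|q| ^+ i).
  rewrite addnC; elim: (m) => [|k IH]; first by rewrite addn0.
  rewrite addnS big_ord_recr /=; apply: le_trans IH _.
  by rewrite ler_peMr ?prodr_ge0 // lerDl mulr_ge0 ?exprn_ge0.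
move=> /le_trans; apply; rewrite big_split_ord /=; apply: ler_wpM2l;
  first exact: prodr_ge0.
have -> : \prod_(i < n) (1 + B * `|q| ^+ (m + i)) = \prod_(i < n) (1
  + B * `|q| ^+ m * `|q| ^+ i).
  by apply: eq_bigr => i _; rewrite exprD mulrA.
apply: le_trans (prod_geo_le _ _ _ _ _ _ _ _) _ => //;
  first by rewrite mulr_ge0 ?exprn_ge0.
rewrite -[2 in leRHS]/(1 + 1) lerD2l ler_pdivrMr // mul1r; apply: le_trans Bm.
by rewrite ler_piMr ?mulr_ge0 ?exprn_ge0 // gerBl exprn_ge0.
Qed.

(** The increments of the partial products are - (x; q)_n x q^n, and they sum geometrically. Since K
    does not depend on n, the estimate passes to the infinite product. *)
Lemma qpoch_sub1 (C : numFieldType) (hC : geo_complete C) (q B : C) :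
  `|q| < 1 -> 0 <= B -> exists2 K : C, 0 <= K &
  forall x n, `|x| <= B -> `|qpoch q x n - 1| <= K * `|x|.
Proof.
move=> q1 B0; have q10 : 0 < 1 - `|q| by rewrite subr_gt0.
have [K K0 HK] := qpoch_bounded C hC q B q1 B0.
exists (K / (1 - `|q|)); first by rewrite divr_ge0 // ltW.
move=> x n xB.
have : `|qpoch q x n - 1| <= K * `|x| * (1 - `|q| ^+ n) / (1 - `|q|).
  elim: n => [|n IH]; first by rewrite qpoch0 expr0 !subrr normr0 mulr0 mul0r.
  have -> : qpoch q x n.+1 - 1 = qpoch q x n - 1 - qpoch q x n * (x * q ^+ n).
    by rewrite qpochSr; ring.
  apply: le_trans (ler_normB _ _) _.
  have -> : K * `|x| * (1 - `|q| ^+ n.+1) / (1 - `|q|) =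
    K * `|x| * (1 - `|q| ^+ n) / (1 - `|q|) + K * (`|x| * `|q| ^+ n).
    by rewrite exprS; field; rewrite gt_eqF.
  apply: lerD => //; rewrite normrM normrM normrX.
  apply: ler_wpM2r; last exact: HK.
  by rewrite mulr_ge0 ?exprn_ge0.
move=> /le_trans; apply; rewrite [leRHS]mulrAC; apply: ler_wpM2r;
  first by rewrite invr_ge0 ltW.
rewrite ler_piMr ?mulr_ge0 //; by rewrite gerBl exprn_ge0.
Qed.

(** The partial products are 1 minus the partial sums of a geometrically dominated series, so
    [geo_complete] suffices. *)
Lemma qpoch_cvg (C : numFieldType) (hC : geo_complete C) (q x : C) :
  `|q| < 1 -> qpoch q x @ \oo --> qpoch_inf q x.
Proof.
move=> q1; have [K K0 HK] := qpoch_bounded C hC q `|x| q1 (normr_ge0 _).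
have : cvgn (series (fun k => qpoch q x k * (x * q ^+ k))).
  apply: (hC _ (K * `|x|) `|q|) => // k; rewrite normrM normrM normrX mulrA.
  by rewrite ler_wpM2r ?exprn_ge0 // ler_wpM2r // HK.
move/cvg_ex => [l Hl]; apply: (cvgP (1 - l)).
have -> : qpoch q x = (fun n => 1 - series (fun k => qpoch q x k * (x * q ^+ k)) n).
  apply/funext; elim => [|n IH]; first by rewrite qpoch0 /series /= big_geq //
    subr0.
  rewrite /series /= big_nat_recr //= opprD addrA.
  by rewrite [X in X - _](esym IH) qpochSr; ring.
by apply: cvgB => //; exact: cvg_cst.
Qed.

Lemma qpoch_infS (C : numFieldType) (hC : geo_complete C) (q x : C) :
  `|q| < 1 -> qpoch_inf q x = (1 - x) * qpoch_inf q (x * q).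
Proof.
move=> q1; apply: cvg_lim; first exact: norm_hausdorff.
rewrite -(cvg_shiftS (qpoch q x)).
rewrite (_ : [sequence _]_n = fun n => (1 - x) * qpoch q (x * q) n); last first.
  by apply/funext => n /=; rewrite qpochSl.
by apply: cvgM; [exact: cvg_cst | exact: qpoch_cvg].
Qed.

Lemma cvg_lipschitz_at0 (C : numFieldType) (F : C -> C) (K : C) (y : nat -> C) :
  (forall x, `|x| <= 1 -> `|F x - 1| <= K * `|x|) -> y @ \oo --> 0 ->
  (fun n => F (y n)) @ \oo --> (1 : C).
Proof.
move=> HF y0.
have Ky : (fun n => K * `|y n|) @ \oo --> 0.
  by rewrite -[X in _ --> X](mulr0 K); apply: cvgM;
    [exact: cvg_cst | exact/norm_cvg0P].
apply/cvgrPdist_lt => e e0.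
move/cvgr0Pnorm_lt : Ky => /(_ e e0) [N _ HN].
move/cvgr0Pnorm_lt : y0 => /(_ 1 ltr01) [M _ HM].
exists (maxn N M) => // n /=; rewrite geq_max => /andP[Nn Mn].
have H := HF _ (ltW (HM n Mn)).
rewrite distrC; apply: le_lt_trans H _; apply: le_lt_trans (HN n Nn) => //=.
(* K is not assumed real, but its product with |y n| is, because it bounds a norm. *)
rewrite real_ler_norm // ger0_real //.
exact: le_trans (normr_ge0 _) (HF _ (ltW (HM n Mn))).
Qed.

Lemma cvg_qpoch1 (C : numFieldType) (hC : geo_complete C) (q : C) (y : nat -> C) k :
  `|q| < 1 -> y @ \oo --> 0 -> (fun n => qpoch q (y n) k) @ \oo --> (1 : C).
Proof.
move=> q1; have [K K0 HK] := qpoch_sub1 C hC q 1 q1 ler01.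
by apply: (cvg_lipschitz_at0 C (fun x => qpoch q x k) K) => x /HK.
Qed.

Lemma cvg_qpoch_inf1 (C : numFieldType) (hC : geo_complete C) (q : C) (y : nat ->
  C) :
  `|q| < 1 -> y @ \oo --> 0 -> (fun n => qpoch_inf q (y n)) @ \oo --> (1 : C).
Proof.
move=> q1; have [K K0 HK] := qpoch_sub1 C hC q 1 q1 ler01.
apply: (cvg_lipschitz_at0 C (qpoch_inf q) K) => x x1.
apply: (cvg_dist_le _ _ _ _ _ 0 (qpoch_cvg C hC q x q1)) => n _; exact: HK.
Qed.

Lemma qpoch_inf_bounded (C : numFieldType) (hC : geo_complete C) (q B : C) :
  `|q| < 1 -> 0 <= B -> exists2 K : C, 0 <= K &
  forall x, `|x| <= B -> `|qpoch_inf q x| <= K.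
Proof.
move=> q1 B0; have [K K0 HK] := qpoch_bounded C hC q B q1 B0.
exists K => // x xB; rewrite -[qpoch_inf q x]subr0.
apply: (cvg_dist_le _ _ _ _ _ 0 (qpoch_cvg C hC q x q1)) => n _.
by rewrite subr0; exact: HK.
Qed.

Lemma qpoch_infD (C : numFieldType) (hC : geo_complete C) (q x : C) n :
  `|q| < 1 -> qpoch_inf q x = qpoch q x n * qpoch_inf q (x * q ^+ n).
Proof.
move=> q1; elim: n => [|n IH]; first by rewrite qpoch0 expr0 mulr1 mul1r.
by rewrite qpochSr IH [in LHS]qpoch_infS // exprSr !mulrA.
Qed.

Lemma qpoch_neq0 (C : numFieldType) (q x : C) n :
  (forall i, 1 - x * q ^+ i != 0) -> qpoch q x n != 0.
Proof. by move=> H; apply/prodf_neq0 => i _; exact: H. Qed.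

Lemma cvg_mul_geo0 (C : numFieldType) (hC : geo_complete C) (q x : C) (e : nat ->
  nat) :
  `|q| < 1 -> (forall n, (n <= e n)%N) -> (fun n => x * q ^+ e n) @ \oo --> 0.
Proof.
move=> q1 en; rewrite -[X in _ --> X](mulr0 x); apply: cvgM; first exact: cvg_cst.
apply: (@cvg_comp _ _ _ e (fun n => q ^+ n)); last exact: (cvg_geo0 C hC).
by apply/cvgnyPge => A; exists A => // n /= An; exact: leq_trans (en n).
Qed.

(** The tails (x q^N; q)_oo tend to 1, so one of them is nonzero, and only finitely many nonzero
    factors precede it. *)
Lemma qpoch_inf_neq0 (C : numFieldType) (hC : geo_complete C) (q x : C) :
  `|q| < 1 -> (forall i, 1 - x * q ^+ i != 0) -> qpoch_inf q x != 0.
Proof.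
move=> q1 H.
have : (fun n => qpoch_inf q (x * q ^+ n)) @ \oo --> (1 : C).
  by apply: cvg_qpoch_inf1 => //; exact: (cvg_mul_geo0 C hC q x id).
move/cvgrPdist_lt => /(_ 1 ltr01) [N _ /(_ N (leqnn N)) /= HN].
rewrite (qpoch_infD C hC q x N) // mulf_neq0 ?qpoch_neq0 //.
by apply: contraTneq HN => ->; rewrite subr0 normr1 ltxx.
Qed.

(** * Families bounded uniformly in two indices, and dominated convergence *)

(** Here n is the shift c q^n and k the summation index; uniformity in both is the domination that
    [tannery] requires. A single sequence is treated as a family constant in n. *)
Definition bounded2 (C : numFieldType) (u : nat -> nat -> C) : Prop :=
  exists K : C, forall n k, `|u n k| <= K.

Lemma bounded2M (C : numFieldType) (u v : nat -> nat -> C) :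
  bounded2 C u -> bounded2 C v -> bounded2 C (fun n k => u n k * v n k).
Proof.
move=> [K HK] [L HL]; exists (K * L) => n k; rewrite normrM.
by apply: ler_pM.
Qed.

Lemma bounded2_cst (C : numFieldType) (x : C) : bounded2 C (fun _ _ => x).
Proof. by exists `|x|. Qed.

Lemma bounded2_1B (C : numFieldType) (u : nat -> nat -> C) :
  bounded2 C u -> bounded2 C (fun n k => 1 - u n k).
Proof.
move=> [K HK]; exists (1 + K) => n k; apply: le_trans (ler_normB _ _) _.
by rewrite normr1 lerD2l.
Qed.

Lemma bounded2_exp (C : numFieldType) (q : C) (e : nat -> nat -> nat) :
  `|q| < 1 -> bounded2 C (fun n k => q ^+ e n k).
Proof.
by move=> q1; exists 1 => n k; rewrite normrX exprn_ile1 // ltW.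
Qed.

Lemma bounded2_qpoch (C : numFieldType) (hC : geo_complete C) (q : C) (u : nat ->
  nat -> C)
  (m : nat -> nat -> nat) : `|q| < 1 -> bounded2 C u ->
  bounded2 C (fun n k => qpoch q (u n k) (m n k)).
Proof.
move=> q1 [B HB]; have B0 : 0 <= B := le_trans (normr_ge0 _) (HB 0%N 0%N).
have [K _ HK] := qpoch_bounded C hC q B q1 B0.
by exists K => n k; exact: HK.
Qed.

Lemma bounded2_qpoch_inf (C : numFieldType) (hC : geo_complete C) (q : C)
  (u : nat -> nat -> C) : `|q| < 1 -> bounded2 C u ->
  bounded2 C (fun n k => qpoch_inf q (u n k)).
Proof.
move=> q1 [B HB]; have B0 : 0 <= B := le_trans (normr_ge0 _) (HB 0%N 0%N).
have [K _ HK] := qpoch_inf_bounded C hC q B q1 B0.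
by exists K => n k; exact: HK.
Qed.

(** Since 1 / (x q^e; q)_oo = (x; q)_e / (x; q)_oo, an upper bound for finite symbols replaces a
    lower bound for infinite ones. *)
Lemma bounded2_qpoch_infV (C : numFieldType) (hC : geo_complete C) (q x : C)
  (e : nat -> nat -> nat) : `|q| < 1 -> (forall i, 1 - x * q ^+ i != 0) ->
  bounded2 C (fun n k => (qpoch_inf q (x * q ^+ e n k))^-1).
Proof.
move=> q1 H.
have [K HK] := bounded2M C _ _ (bounded2_qpoch C hC q (fun _ _ =>
  x) e q1 (bounded2_cst C x))
  (bounded2_cst C (qpoch_inf q x)^-1).
exists K => n k; have := HK n k; congr (`|_| <= _).
by rewrite (qpoch_infD C hC q x (e n k)) // invfM mulVKf // qpoch_neq0.
Qed.

(** Here 1 / (x q^e; q)_m = (x q^(e+m); q)_oo / (x q^e; q)_oo, and both factors are already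
    bounded. *)
Lemma bounded2_qpochV (C : numFieldType) (hC : geo_complete C) (q x : C)
  (e m : nat -> nat -> nat) : `|q| < 1 -> (forall i, 1 - x * q ^+ i != 0) ->
  bounded2 C (fun n k => (qpoch q (x * q ^+ e n k) (m n k))^-1).
Proof.
move=> q1 H.
have Hs n k : qpoch_inf q (x * q ^+ (e n k + m n k)) != 0.
  by apply: qpoch_inf_neq0 => // i; rewrite -mulrA -exprD.
have B := bounded2M C _ _ (bounded2_qpoch_infV C hC q x e q1 H)
  (bounded2_qpoch_inf C hC q _ q1
  (bounded2M C _ _ (bounded2_cst C x) (bounded2_exp C q (fun n k =>
    e n k + m n k)%N q1))).
case: B => K HK; exists K => n k; have := HK n k; congr (`|_| <= _).
rewrite (qpoch_infD C hC q (x * q ^+ e n k) (m n k)) // -mulrA -exprD invfM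
  mulfVK //.
Qed.

Lemma cvg_series_bounded2 (C : numFieldType) (hC : geo_complete C) (u : nat ->
  nat -> C) z n :
  `|z| < 1 -> bounded2 C u -> cvgn (series (fun k => u n k * z ^+ k)).
Proof.
move=> z1 [K HK]; apply: (hC _ K `|z|) => // k.
by rewrite normrM normrX ler_wpM2r // exprn_ge0.
Qed.

(** The first m norms are kept as they are, because in [tannery] they tend to 0 one by one; only the
    tail is replaced by its geometric bound. *)
Lemma series_geo_tail (C : numFieldType) (a : nat -> C) (K r : C) m n :
  0 <= r -> r < 1 -> (forall k, `|a k| <= K * r ^+ k) -> (m <= n)%N ->
  `|series a n| <= \sum_(k < m) `|a k| + K * r ^+ m / (1 - r).
Proof.
move=> r0 r1 Ha mn; have r10 : 0 < 1 - r by rewrite subr_gt0.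
have K0 : 0 <= K by have := Ha 0%N; rewrite expr0 mulr1; exact: le_trans.
apply: le_trans (_ : \sum_(k < m) `|a k| + K * (r ^+ m - r ^+ n) / (1 - r) <= _);
  last first.
  rewrite lerD2l ler_pM2r ?invr_gt0 //; apply: ler_wpM2l => //.
  by rewrite gerBl exprn_ge0.
rewrite -(subnK mn) addnC; elim: (n - m)%N => [|j IH].
  rewrite addn0 subrr mulr0 mul0r addr0 /series /= big_mkord; exact: ler_norm_sum.
rewrite addnS /series /= big_nat_recr //=; apply: le_trans (ler_normD _ _) _.
have -> : \sum_(k < m) `|a k| + K * (r ^+ m - r ^+ (m + j).+1) / (1 - r) =
  (\sum_(k < m) `|a k| + K * (r ^+ m - r ^+ (m + j)) / (1 - r)) + K * r ^+ (m + j).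
  by rewrite exprS; field; rewrite gt_eqF.
exact: lerD.
Qed.

(** Dominated convergence for series: the difference of the two sums is at most a finite sum, which
    tends to 0 with n, plus a tail bound independent of n. *)
Lemma tannery (C : numFieldType) (hC : geo_complete C) (u : nat -> nat ->
  C) (v : nat -> C) z :
  `|z| < 1 -> bounded2 C u -> (forall k, (fun n => u n k) @ \oo --> v k) ->
  (fun n => limn (series (fun k => u n k * z ^+ k))) @ \oo -->
  limn (series (fun k => v k * z ^+ k)).
Proof.
move=> z1 bu uv; have z10 : 0 < 1 - `|z| by rewrite subr_gt0.
have [K HK] := bu.
have HvK k : `|v k| <= K.
  rewrite -[v k]subr0; apply: (cvg_dist_le _ _ _ _ _ 0 (uv k)) => n _.
  by rewrite subr0.
have bv : bounded2 C (fun _ => v) by exists K.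
pose g n k := (u n k - v k) * z ^+ k.
have gK n k : `|g n k| <= 2 * K * `|z| ^+ k.
  rewrite normrM normrX; apply: ler_wpM2r; first exact: exprn_ge0.
  by apply: le_trans (ler_normB _ _) _; rewrite mulr_natl mulr2n lerD.
have main m n : `|limn (series (fun k =>
  u n k * z ^+ k)) - limn (series (fun k => v k * z ^+ k))|
   <= \sum_(k < m) `|g n k| + 2 * K * `|z| ^+ m / (1 - `|z|).
  rewrite -[X in `|X|]subr0.
  apply: (cvg_dist_le _ (series (g n)) _ _ _ m); last first.
    by move=> N mN; rewrite subr0; exact: series_geo_tail.
  have -> : series (g n) = series (fun k => u n k * z ^+ k) - series (fun k =>
    v k * z ^+ k).
    by apply/funext => N; rewrite /series /= fctE -sumrB; apply: eq_bigr => i _;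
      rewrite /g mulrBl.
  by apply: cvgB; [exact: (cvg_series_bounded2 C hC u) | exact:
    (cvg_series_bounded2 C hC (fun=> v) z 0%N)].
apply/cvgrPdist_lt => e e0.
have e20 : 0 < e / 2 by rewrite divr_gt0.
have : (fun m => 2 * K / (1 - `|z|) * `|z| ^+ m) @ \oo --> 0.
  rewrite -[X in _ --> X](mulr0 (2 * K / (1 - `|z|))).
  by apply: cvgM; [exact: cvg_cst | apply: (cvg_geo0 C hC); rewrite normr_id].
(* The cut m is fixed first, from the tail; n is then taken large for the finitely many remaining
   terms. *)
move/cvgr0Pnorm_lt => /(_ _ e20) [m _ /(_ m (leqnn m)) /= Hm].
have : (fun n => \sum_(k < m) `|g n k|) @ \oo --> 0.
  elim: (m) => [|j IH].
    by under eq_fun do rewrite big_ord0; exact: cvg_cst.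
  have -> : (fun n => \sum_(k < j.+1) `|g n k|) = (fun n =>
    \sum_(k < j) `|g n k| + `|g n j|).
    by apply/funext => n; rewrite big_ord_recr.
  rewrite -[X in _ --> X](addr0 0); apply: cvgD IH _.
  apply/norm_cvg0P; rewrite -[X in _ --> X](mul0r (z ^+ j)).
  by apply: cvgM; [exact/subr_cvg0 | exact: cvg_cst].
move/cvgr0Pnorm_lt => /(_ _ e20) [N _ HN]; exists N => // n /= Nn.
rewrite distrC; apply: le_lt_trans (main m n) _; rewrite [ltRHS]splitr; apply: ltrD.
  by apply: le_lt_trans (HN n Nn); rewrite /= ger0_norm // sumr_ge0.
apply: le_lt_trans Hm; rewrite [leLHS]mulrAC real_ler_norm // ger0_real //
  mulr_ge0 ?exprn_ge0 //.
rewrite divr_ge0 ?(ltW z10) // mulr_ge0 //; exact: le_trans (HvK 0%N).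
Qed.

(** * Series manipulations, telescoping and the q-binomial theorem *)

Lemma one_subMX_neq0 (C : numFieldType) (x q : C) i :
  `|x| < 1 -> `|q| < 1 -> 1 - x * q ^+ i != 0.
Proof.
move=> x1 q1; rewrite subr_eq0; apply: contraTneq x1 => H.
have : `|x * q ^+ i| <= `|x| by rewrite normrM normrX ler_piMr // exprn_ile1 // ltW.
rewrite -H normr1 => H1; apply/negP => H2; have := le_lt_trans H1 H2;
  by rewrite ltxx.
Qed.

Lemma limn_seriesM (C : numFieldType) (f : nat -> C) (a : C) :
  cvgn (series f) -> limn (series (fun k => a * f k)) = a * limn (series f).
Proof.
move=> cf; apply: cvg_lim; first exact: norm_hausdorff.
have -> : series (fun k => a * f k) = (fun n => a * series f n).
  by apply/funext => n; rewrite /series /= mulr_sumr.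
by apply: cvgM => //; exact: cvg_cst.
Qed.

Lemma cvgn_seriesM (C : numFieldType) (f : nat -> C) (a : C) :
  cvgn (series f) -> cvgn (series (fun k => a * f k)).
Proof.
move=> cf; apply: (cvgP (a * limn (series f))).
have -> : series (fun k => a * f k) = (fun n => a * series f n).
  by apply/funext => n; rewrite /series /= mulr_sumr.
by apply: cvgM => //; exact: cvg_cst.
Qed.

(** The shifts i, j, k let a relation couple summands at different indices. The last hypothesis
    states that the initial terms left out by the shifts add up to G 0, so all partial sums combine
    to G n. *)
Lemma telescope_lim (C : numFieldType) (f0 f1 f2 G : nat -> C) i j k :
  cvgn (series f0) -> cvgn (series f1) -> cvgn (series f2) ->
  G @ \oo --> 0 ->
  (forall n, f0 (n + i)%N + f1 (n + j)%N + f2 (n + k)%N = G n.+1 - G n) ->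
  series f0 i + series f1 j + series f2 k = G 0%N ->
  limn (series f0) + limn (series f1) + limn (series f2) = 0.
Proof.
move=> c0 c1 c2 G0 step init.
have H n : series f0 (n + i)%N + series f1 (n + j)%N + series f2 (n + k)%N = G n.
  elim: n => [|n IH]; first by rewrite !add0n.
  move: IH (step n); rewrite /series /= !addSn !big_nat_recr //= => IH E.
  by rewrite -[RHS](subrK (G n)) -E -IH; ring.
have sh (f : nat -> C) m : cvgn (series f) ->
  (fun n => series f (n + m)%N) @ \oo --> limn (series f).
  by move=> cf; have := cf; rewrite -{1}(cvg_shiftn m (series f)).
have L : (fun n => series f0 (n + i)%N + series f1 (n + j)%N + series f2 (n
  + k)%N) @ \oo -->
   limn (series f0) + limn (series f1) + limn (series f2).
  by apply: cvgD; [apply: cvgD|]; exact: sh.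
have := cvg_lim (@norm_hausdorff _ _) L; rewrite (_ : (fun n => _) = G);
  last exact/funext.
by move=> <-; apply: cvg_lim => //; exact: norm_hausdorff.
Qed.

(** The sum f satisfies (1 - z) f(z) = (1 - b z) f(z q). Iteration gives (z; q)_n f(z) = (b z; q)_n
    f(z q^n), and f(z q^n) tends to 1. *)
Lemma q_binomial (C : numFieldType) (hC : geo_complete C) (q b z : C) :
  `|q| < 1 -> `|z| < 1 ->
  limn (series (fun k => qpoch q b k / qpoch q q k * z ^+ k)) =
  qpoch_inf q (b * z) / qpoch_inf q z.
Proof.
move=> q1 z1; pose c k := qpoch q b k / qpoch q q k.
pose f (w : C) : C := limn (series (fun k => c k * w ^+ k)).
have bc : bounded2 C (fun _ k => c k).
  apply: bounded2M; first exact: bounded2_qpoch hC _ _ _ q1 (bounded2_cst C b).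
  have := bounded2_qpochV C hC q q (fun _ _ => 0%N) (fun _ k => k) q1 (fun i =>
    one_subMX_neq0 C q q i q1 q1).
  by under eq_fun do under eq_fun do rewrite expr0 mulr1.
have cf (w : C) : `|w| < 1 -> cvgn (series (fun k => c k * w ^+ k)).
  by move=> w1; exact: (cvg_series_bounded2 C hC (fun _ => c) w 0%N w1 bc).
have cS k : c k.+1 * (1 - q ^+ k.+1) = c k * (1 - b * q ^+ k).
  rewrite /c !qpochSr -exprS; field.
  by rewrite !qpoch_neq0 => [|i]; [rewrite exprS|]; exact: one_subMX_neq0.
have fq (w : C) : `|w| < 1 -> (1 - w) * f w = (1 - b * w) * f (w * q).
  move=> w1.
  have wq1 : `|w * q| < 1 by rewrite normrM mulr_ilt1.
  have sh (g : nat -> C) (v : C) : cvgn (series g) ->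
    (fun n => series g n.+1 - v * series g n) @ \oo --> (1 - v) * limn (series g).
    move=> cg; rewrite mulrBl mul1r; apply: cvgB; last by apply: cvgM;
      [exact: cvg_cst|].
    by have := cg; rewrite -{1}(cvg_shiftS (series g)).
  have L1 := sh _ w (cf w w1); have L2 := sh _ (b * w) (cf _ wq1).
  have := cvg_lim (@norm_hausdorff _ _) L1; rewrite /f => <-.
  have := cvg_lim (@norm_hausdorff _ _) L2 => <-; congr (limn _).
  (* The functional equation already holds between partial sums, when the one multiplied by w or b w
     stops one term earlier. *)
  apply/funext; elim => [|n IH].
    by rewrite /series /= !big_nat1 !big_geq // !expr0; ring.
  move: IH; rewrite /series /= !(@big_nat_recr _ _ _ n.+1 0) //= !(@big_nat_recr
    _ _ _ n 0) //=.
  set s1 := \sum_(0 <= i < n) _; set s2 := \sum_(0 <= i < n) _ => IH.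
  transitivity (s1 + c n * w ^+ n - w * s1 + (c n.+1 - c n) * w ^+ n.+1).
    by rewrite exprS; ring.
  rewrite IH.
  have -> : c n.+1 - c n = c n.+1 * q ^+ n.+1 - c n * (b * q ^+ n).
    transitivity (c n.+1 * (1 - q ^+ n.+1) + c n.+1 * q ^+ n.+1 - c n);
      first by ring.
    by rewrite cS; ring.
  by rewrite !exprMn !exprS; ring.
have it n : qpoch q z n * f z = qpoch q (b * z) n * f (z * q ^+ n).
  elim: n => [|n IH]; first by rewrite !qpoch0 expr0 mulr1.
  rewrite !qpochSr mulrAC IH -!mulrA; congr (_ * _); rewrite mulrC fq.
    by rewrite exprSr !mulrA.
  by rewrite normrM normrX; apply: le_lt_trans z1;
    rewrite ler_piMr // exprn_ile1 // ltW.
have L1 : (fun n => qpoch q z n * f z) @ \oo --> qpoch_inf q z * f z.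
  by apply: cvgM; [exact: qpoch_cvg | exact: cvg_cst].
(* As a series in z, f(z q^n) has the coefficients c_k q^(n k), which tend to 1 for k = 0 and to 0
   otherwise. *)
have f1 : (fun n => f (z * q ^+ n)) @ \oo --> (1 : C).
  have := tannery C hC (fun n k => c k * q ^+ (n * k)) (fun k =>
    (k == 0%N)%:R) z z1.
  have -> : limn (series (fun k => (k == 0%N)%:R * z ^+ k)) = 1.
    apply: cvg_lim; first exact: norm_hausdorff.
    apply: cvg_near_cst; exists 1%N => // -[//|n] _ /=.
    rewrite /series /= big_nat_recl //= expr0 mulr1 big1 ?addr0 // => i _.
    by rewrite mul0r.
  have -> : (fun n => f (z * q ^+ n)) =
     (fun n => limn (series (fun k => c k * q ^+ (n * k) * z ^+ k))).
    apply/funext => n; rewrite /f; congr (limn (series _)); apply/funext => k.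
    by rewrite exprMn -exprM; ring.
  apply; first by apply: bounded2M => //; exact: bounded2_exp.
  case=> [|k] /=.
    under eq_fun do rewrite muln0 expr0 mulr1 /c !qpoch0 divr1; exact: cvg_cst.
  by apply: (cvg_mul_geo0 C hC) => // n; rewrite leq_pmulr.
have L2 : (fun n => qpoch q (b * z) n * f (z
  * q ^+ n)) @ \oo --> qpoch_inf q (b * z) * 1.
  by apply: cvgM => //; exact: qpoch_cvg.
have z0 : qpoch_inf q z != 0.
  by apply: qpoch_inf_neq0 => // i; exact: one_subMX_neq0.
apply: (mulfI z0); rewrite mulrCA divff // -(cvg_lim (@norm_hausdorff _ _) L1).
rewrite -(cvg_lim (@norm_hausdorff _ _) L2); congr (limn _); exact/funext.
Qed.

(** * Summands of both sides and their recurrences *)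

Definition lcoef (C : numFieldType) (q b c : C) (k : nat) : C :=
  qpoch q (b * c) k * qpoch q b k / (qpoch q q k * qpoch q (q * c) k).

(** What the nonvanishing hypotheses become in b, c, t: the symbols in q c, q c^2 and b c^2 t = a^2
    b^-1 t. The condition is stable under both shifts of the contiguous relations. *)
Definition admissible (C : numFieldType) (q b c t : C) : Prop :=
  forall n, [/\ 1 - q * c * q ^+ n != 0, 1 - q * c ^+ 2 * q ^+ n != 0
    & 1 - b * c ^+ 2 * t * q ^+ n != 0].

Lemma qpochSlE (C : numFieldType) (q x y : C) n :
  y = x * q -> qpoch q x n.+1 = (1 - x) * qpoch q y n.
Proof. by move=> ->; exact: qpochSl. Qed.

(** Both sides come from splitting (x; q)_(i+m) in two ways. It serves the symbols in q c^2, whose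
    base moves by q^2 for each factor q of c while the index drops by 1 only, so that factors differ
    at both ends. *)
Lemma qpoch_swap (C : numFieldType) (q x y : C) i m j n :
  (i + m = j + n)%N -> qpoch q (x * q ^+ i) m != 0 -> y = x * q ^+ j ->
  qpoch q x i = qpoch q x j * qpoch q y n / qpoch q (x * q ^+ i) m.
Proof. by move=> e h ->; apply: (canRL (mulfK h)); rewrite -!qpochD e. Qed.

(** The side conditions of [field] come back in its own form; each is closed by a hypothesis equal
    to it up to [ring]. *)
Ltac nonzero := repeat (apply/andP; split); first
  [ assumption
  | match goal with h : is_true (_ != _) |- _ =>
      solve [move: h; congr (_ != _); ring] end ].

(* The three summands are taken at the indices n + 2, n + 1 and n because the
   parameters of the term at c q^j and index k depend mostly on j + k; with this
   alignment the certificate G is a single product, here and in [rcoef_rec_c],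
   [lcoef_rec_bct] and [rcoef_rec_bct]. *)
Lemma lcoef_rec_c (C : numFieldType) (q b c t : C) n :
  `|q| < 1 -> (forall n, 1 - q * c * q ^+ n != 0) ->
  let z := q * t ^+ 2 in
  let G n := t ^+ 2 * (q - b) * (1 - b * c * q) * ((1 - q ^+ 2 * c * q ^+ n)
     / (1 - q * q ^+ n)) * (lcoef C q b (c * q ^+ 2) n * z ^+ n) in
  (1 - q * c) * (1 - q ^+ 2 * c) * (lcoef C q b c (n + 2) * z ^+ (n + 2))
  + - ((1 - q * c) * (1 - q ^+ 2 * c) * (1 + b * t ^+ 2))
    * (lcoef C q b (c * q) (n + 1) * z ^+ (n + 1))
  + t ^+ 2 * (b - q ^+ 2 * c) * (1 - b * c * q)
    * (lcoef C q b (c * q ^+ 2) (n + 0) * z ^+ (n + 0)) = G n.+1 - G n.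
Proof.
move=> q1 Hc z G; rewrite /G /lcoef !addn0 addn1 addn2.
have := one_subMX_neq0 C q q n q1 q1.
have := one_subMX_neq0 C q q n.+1 q1 q1.
have : qpoch q q n != 0 by apply: qpoch_neq0 => i; exact: one_subMX_neq0.
have : qpoch q (q * (c * q ^+ 2)) n != 0.
  apply: qpoch_neq0 => i; have := Hc i.+2; congr (_ != _); rewrite !exprS; ring.
have := Hc 0%N; have := Hc 1%N; have := Hc n.+2.
rewrite (qpochSlE C q (b * c) (b * (c * q))) ?(qpochSlE C q (b * (c * q)) (b
  * (c * q ^+ 2))); try ring.
rewrite (qpochSlE C q (q * c) (q * (c * q))) ?(qpochSlE C q (q * (c * q)) (q
  * (c * q ^+ 2))); try ring.
rewrite !qpochSr /z !exprS !expr0.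
(* Every symbol is now one of four, at c q^2 and index n. With these and the powers abstracted, an
   identity of rational functions remains. *)
move: (q ^+ n) (_ ^+ n) (qpoch _ _ _) (qpoch _ _ _) (qpoch _ _ _) (qpoch _ _ _)
  => X Z p1 p2 p3 p4.
move=> h1 h2 h3 h4 h5 h6 h7.
field; nonzero.
Qed.

(* The k-th term of the 8-phi-7, without its power of q t, times the part of the
   prefactor that depends on b and c. Absorbing this part cancels every
   denominator but those in c, c^2 and b c^2 t = a^2 b^-1 t. Products in base
   q^2 stand for the pairs of parameters with opposite signs. *)
Definition rcoef (C : numFieldType) (q b c t : C) (k : nat) : C :=
  (1 - b * c ^+ 2 * t * (q ^+ k) ^+ 2)
  * (qpoch_inf (q ^+ 2) (q * (b * c * t * q ^+ k) ^+ 2)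
     * qpoch_inf q (- (q * (b * c * t * q ^+ k))) * qpoch_inf q (q * c * t * q ^+ k)
     / qpoch_inf q (b * c ^+ 2 * t * q ^+ k))
  * (qpoch q (b * t) k * qpoch q (b * c) k * qpoch (q ^+ 2) (q * c ^+ 2) k
     * qpoch q (- c) k / (qpoch q q k * qpoch q (q * c ^+ 2) k)).

Lemma rcoef_rec_c (C : numFieldType) (hC : geo_complete C) (q b c t : C) n :
  `|q| < 1 -> admissible C q b c t ->
  let z := q * t in
  let G n := t * (q - b * t) * (1 - b * c * q) * (1 - q ^+ 2 * c ^+ 2)
     * (1 - q ^+ 2 * c) / (1 - q ^+ 4 * c ^+ 2)
     * ((1 - q ^+ 4 * c ^+ 2 * q ^+ n) / (1 - q * q ^+ n))
     * (qpoch_inf (q ^+ 2) (q * (b * c * t * q ^+ n.+1) ^+ 2)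
     * qpoch_inf q (- (q * (b * c * t * q ^+ n.+1))) * qpoch_inf q (q * c * t
       * q ^+ n.+1)
     / qpoch_inf q (b * c ^+ 2 * t * q ^+ n.+2))
     * (qpoch q (b * t) n * qpoch q (b * (c * q ^+ 2)) n
        * qpoch (q ^+ 2) (q * (c * q ^+ 2) ^+ 2) n * qpoch q (- (c * q ^+ 2)) n
        / (qpoch q q n * qpoch q (q * (c * q ^+ 2) ^+ 2) n)) * z ^+ n in
  (1 - q * c) * (1 - q ^+ 2 * c) * (rcoef C q b c t (n + 2) * z ^+ (n + 2))
  + - ((1 - q * c) * (1 - q ^+ 2 * c) * (1 + b * t ^+ 2))
    * (rcoef C q b (c * q) t (n + 1) * z ^+ (n + 1))
  + t ^+ 2 * (b - q ^+ 2 * c) * (1 - b * c * q)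
    * (rcoef C q b (c * q ^+ 2) t (n + 0) * z ^+ (n + 0)) = G n.+1 - G n.
Proof.
move=> q1 Hg z G; rewrite /G /rcoef !addn0 addn1 addn2.
have q21 : `|q ^+ 2| < 1 by rewrite normrX exprn_ilt1.
have := one_subMX_neq0 C q q n q1 q1.
have := one_subMX_neq0 C q q n.+1 q1 q1.
have : qpoch q q n != 0 by apply: qpoch_neq0 => i; exact: one_subMX_neq0.
have : qpoch q (q * (c * q ^+ 2) ^+ 2) n != 0.
  apply: qpoch_neq0 => i; have [_ + _] := Hg i.+4; congr (_ != _);
    rewrite !exprS; ring.
have : qpoch_inf q (b * c ^+ 2 * t * q ^+ n.+4) != 0.
  apply: qpoch_inf_neq0 => // i; have [_ _] := Hg (n.+4 + i)%N; congr (_ != _);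
    rewrite exprD; ring.
have [_ h _] := Hg 0%N; move: h; have [_ h _] := Hg 1%N; move: h;
  have [_ h _] := Hg 2%N; move: h.
have [_ h _] := Hg 3%N; move: h; have [_ h _] := Hg n.+2; move: h.
have [_ h _] := Hg n.+3; move: h; have [_ h _] := Hg n.+4; move: h.
have [_ _ h] := Hg n.+2; move: h; have [_ _ h] := Hg n.+3; move: h.
(* At c q^j and index n + 2 - j the quantities b c t q^k and q c t q^k do not depend on j; only b
   c^2 t q^k moves, to the exponent n + 2 + j. *)
rewrite (_ : b * (c * q) * t * q ^+ n.+1 = b * c * t * q ^+ n.+2);
  last by rewrite !exprS; ring.
rewrite (_ : b * (c * q ^+ 2) * t * q ^+ n = b * c * t * q ^+ n.+2);
  last by rewrite !exprS; ring.
rewrite (_ : q * (c * q) * t * q ^+ n.+1 = q * c * t * q ^+ n.+2);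
  last by rewrite !exprS; ring.
rewrite (_ : q * (c * q ^+ 2) * t * q ^+ n = q * c * t * q ^+ n.+2);
  last by rewrite !exprS; ring.
rewrite (_ : b * (c * q) ^+ 2 * t * q ^+ n.+1 = b * c ^+ 2 * t * q ^+ n.+3);
  last by rewrite !exprS; ring.
rewrite (_ : b * (c * q ^+ 2) ^+ 2 * t * q ^+ n = b * c ^+ 2 * t * q ^+ n.+4);
  last by rewrite !exprS; ring.
have i4 k : qpoch_inf q (b * c ^+ 2 * t * q ^+ k) =
    (1 - b * c ^+ 2 * t * q ^+ k) * qpoch_inf q (b * c ^+ 2 * t * q ^+ k.+1).
  by rewrite (qpoch_infS C hC) // [q ^+ k.+1]exprSr mulrA.
rewrite (i4 n.+2) (i4 n.+3).
have -> : qpoch_inf q (q * c * t * q ^+ n.+1) =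
   (1 - q * c * t * q ^+ n.+1) * qpoch_inf q (q * c * t * q ^+ n.+2).
  by rewrite (qpoch_infS C hC) // [q ^+ n.+2]exprSr mulrA.
have -> : qpoch_inf q (- (q * (b * c * t * q ^+ n.+1))) =
   (1 + (q * (b * c * t * q ^+ n.+1))) * qpoch_inf q (- (q * (b * c * t
     * q ^+ n.+2))).
  by rewrite (qpoch_infS C hC) // opprK [q ^+ n.+2]exprSr mulNr !mulrA.
have -> : qpoch_inf (q ^+ 2) (q * (b * c * t * q ^+ n.+1) ^+ 2) =
   (1 - (q * (b * c * t * q ^+ n.+1) ^+ 2)) * qpoch_inf (q ^+ 2) (q * (b * c
     * t * q ^+ n.+2) ^+ 2).
  rewrite (qpoch_infS C hC) //; congr (_ * qpoch_inf _ _); rewrite !exprS; ring.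
move: (qpoch_inf _ _) (qpoch_inf _ _) (qpoch_inf _ _) (qpoch_inf _ _) =>
  j1 j2 j3 j4.
rewrite (qpochSlE C q (b * c) (b * (c * q))) ?(qpochSlE C q (b * (c * q)) (b
  * (c * q ^+ 2))); try ring.
rewrite (qpochSlE C q (- c) (- (c * q))) ?(qpochSlE C q (- (c * q)) (- (c
  * q ^+ 2))); try ring.
rewrite (qpochSlE C (q ^+ 2) (q * c ^+ 2) (q * (c
  * q) ^+ 2)) ?(qpochSlE C (q ^+ 2) (q * (c * q) ^+ 2) (q * (c * q ^+ 2) ^+ 2));
  try ring.
have d2 : qpoch q (q * c ^+ 2) n.+2 = qpoch q (q * c ^+ 2) 4
   * qpoch q (q * (c * q ^+ 2) ^+ 2) n / qpoch q (q * c ^+ 2 * q ^+ n.+2) 2.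
  apply: qpoch_swap; [by rewrite ?addn2 ?addn1 | | by ring].
  apply: qpoch_neq0 => i; have [_ + _] := Hg (n.+2 + i)%N; congr (_ != _);
    rewrite exprD; ring.
have d1 : qpoch q (q * (c * q) ^+ 2) n.+1 = qpoch q (q * (c * q) ^+ 2) 2
   * qpoch q (q * (c * q ^+ 2) ^+ 2) n / qpoch q (q * (c * q) ^+ 2 * q ^+ n.+1) 1.
  apply: qpoch_swap; [by rewrite ?addn2 ?addn1 | | by ring].
  apply: qpoch_neq0 => i; have [_ + _] := Hg (n.+3 + i)%N; congr (_ != _);
    rewrite exprD !exprS; ring.
rewrite d1 d2.
rewrite !qpochSr !qpoch0 (exprAC q 2 n) /z !exprS !expr0.
move: (q ^+ n) ((_ * _) ^+ n) (qpoch _ _ _) (qpoch _ _ _) (qpoch _ _ _) (qpoch _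
  _ _) (qpoch _ _ _) (qpoch _ _ _) => X Z p1 p2 p3 p4 p5 p6.
move=> h1 h2 h3 h4 h5 h6 h7 h8 h9 h10 h11 h12 h13 h14.
field; nonzero.
Qed.

Lemma lcoef_rec_bct (C : numFieldType) (q b c t : C) n :
  `|q| < 1 -> q != 0 -> (forall n, 1 - q * c * q ^+ n != 0) ->
  let z := q * t ^+ 2 in
  let G n := (1 - b * c) * (lcoef C q b (c * q) n * z ^+ n) in
  (1 - q ^+ 2 * c ^+ 2) * (lcoef C q b c (n + 1) * z ^+ (n + 1))
  + - ((1 - b * c) * (1 + q ^+ 2 * c * t ^+ 2))
    * (lcoef C q b (c * q) (n + 0) * z ^+ (n + 0))
  + c * (q ^+ 2 * c - b)
    * (lcoef C q (b / q) (c * q) (n + 1) * (q * (t * q) ^+ 2) ^+ (n + 1)) =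
  G n.+1 - G n.
Proof.
move=> q1 q0 Hc z G; rewrite /G /lcoef !addn0 addn1.
have := one_subMX_neq0 C q q n q1 q1.
have : qpoch q q n != 0 by apply: qpoch_neq0 => i; exact: one_subMX_neq0.
have : qpoch q (q * (c * q)) n != 0.
  apply: qpoch_neq0 => i; have := Hc i.+1; congr (_ != _); rewrite !exprS; ring.
have := Hc 0%N; have := Hc n.+1.
rewrite (_ : q * (t * q) ^+ 2 = z * q ^+ 2); last by rewrite /z; ring.
(* The shift leaves a = b c unchanged, so only the symbol in b and the one in q c move. *)
rewrite (_ : b / q * (c * q) = b * c); last by field.
rewrite !(qpochSlE C q (b * c) (b * (c * q))); try ring.
rewrite (qpochSlE C q (b / q) b); last by field.
rewrite (qpochSlE C q (q * c) (q * (c * q))); try ring.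
rewrite !qpochSr (exprMn _ z) (exprAC q 2) /z !exprS !expr0.
move: (q ^+ n) ((_ * _) ^+ n) (qpoch _ _ _) (qpoch _ _ _) (qpoch _ _ _) (qpoch _
  _ _) => X Z p1 p2 p3 p4.
move=> h1 h2 h3 h4 h5.
field; nonzero.
Qed.

Lemma rcoef_rec_bct (C : numFieldType) (hC : geo_complete C) (q b c t : C) n :
  `|q| < 1 -> q != 0 -> admissible C q b c t ->
  let z := q * t in
  let G n := (1 - q * c * t) * (1 - q ^+ 2 * c ^+ 2 * q ^+ n)
     * (qpoch_inf (q ^+ 2) (q * (b * c * t * q ^+ n) ^+ 2)
     * qpoch_inf q (- (q * (b * c * t * q ^+ n))) * qpoch_inf q (q * c * t
       * q ^+ n.+1)
     / qpoch_inf q (b * c ^+ 2 * t * q ^+ n.+1))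
     * (qpoch q (b * t) n * qpoch q (b * c) n
        * qpoch (q ^+ 2) (q * (c * q) ^+ 2) n * qpoch q (- (c * q)) n
        / (qpoch q q n * qpoch q (q * (c * q) ^+ 2) n)) * z ^+ n in
  (1 - q ^+ 2 * c ^+ 2) * (rcoef C q b c t (n + 1) * z ^+ (n + 1))
  + - ((1 - b * c) * (1 + q ^+ 2 * c * t ^+ 2))
    * (rcoef C q b (c * q) t (n + 0) * z ^+ (n + 0))
  + c * (q ^+ 2 * c - b) * ((1 - q * t ^+ 2) * (1 + q * t))
    * (rcoef C q (b / q) (c * q) (t * q) (n + 0) * (q * (t * q)) ^+ (n + 0)) =
  G n.+1 - G n.
Proof.
move=> q1 q0 Hg z G; rewrite /G /rcoef !addn0 addn1.
have q21 : `|q ^+ 2| < 1 by rewrite normrX exprn_ilt1.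
have := one_subMX_neq0 C q q n q1 q1.
have : qpoch q q n != 0 by apply: qpoch_neq0 => i; exact: one_subMX_neq0.
have : qpoch q (q * (c * q) ^+ 2) n != 0.
  apply: qpoch_neq0 => i; have [_ + _] := Hg i.+2; congr (_ != _);
    rewrite !exprS; ring.
have : qpoch_inf q (b * c ^+ 2 * t * q ^+ n.+2) != 0.
  apply: qpoch_inf_neq0 => // i; have [_ _] := Hg (n.+2 + i)%N; congr (_ != _);
    rewrite exprD; ring.
have [_ h _] := Hg 0%N; move: h; have [_ h _] := Hg 1%N; move: h.
have [_ h _] := Hg n.+1; move: h; have [_ h _] := Hg n.+2; move: h.
have [_ _ h] := Hg n.+1; move: h.
rewrite (_ : b * (c * q) * t * q ^+ n = b * c * t * q ^+ n.+1);
  last by rewrite !exprS; ring.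
rewrite (_ : b / q * (c * q) * (t * q) * q ^+ n = b * c * t * q ^+ n.+1);
  last by rewrite !exprS; field.
rewrite (_ : q * (c * q) * t * q ^+ n = q * c * t * q ^+ n.+1);
  last by rewrite !exprS; ring.
rewrite (_ : q * (c * q) * (t * q) * q ^+ n = q * c * t * q ^+ n.+2);
  last by rewrite !exprS; ring.
rewrite (_ : b * (c * q) ^+ 2 * t * q ^+ n = b * c ^+ 2 * t * q ^+ n.+2);
  last by rewrite !exprS; ring.
rewrite (_ : b / q * (c * q) ^+ 2 * (t * q) * q ^+ n = b * c ^+ 2 * t
  * q ^+ n.+2); last by rewrite !exprS; field.
rewrite (_ : b / q * (t * q) = b * t); last by field.
rewrite (_ : b / q * (c * q) = b * c); last by field.
rewrite (_ : q * (t * q) = z * q); last by rewrite /z; ring.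
have -> : qpoch_inf q (b * c ^+ 2 * t * q ^+ n.+1) =
    (1 - b * c ^+ 2 * t * q ^+ n.+1) * qpoch_inf q (b * c ^+ 2 * t * q ^+ n.+2).
  by rewrite (qpoch_infS C hC) // [q ^+ n.+2]exprSr mulrA.
have -> : qpoch_inf q (q * c * t * q ^+ n.+1) =
   (1 - q * c * t * q ^+ n.+1) * qpoch_inf q (q * c * t * q ^+ n.+2).
  by rewrite (qpoch_infS C hC) // [q ^+ n.+2]exprSr mulrA.
have -> : qpoch_inf q (- (q * (b * c * t * q ^+ n))) =
   (1 + (q * (b * c * t * q ^+ n))) * qpoch_inf q (- (q * (b * c * t * q ^+ n.+1))).
  by rewrite (qpoch_infS C hC) // opprK [q ^+ n.+1]exprSr mulNr !mulrA.
have -> : qpoch_inf (q ^+ 2) (q * (b * c * t * q ^+ n) ^+ 2) =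
   (1 - (q * (b * c * t * q ^+ n) ^+ 2)) * qpoch_inf (q ^+ 2) (q * (b * c * t
     * q ^+ n.+1) ^+ 2).
  rewrite (qpoch_infS C hC) //; congr (_ * qpoch_inf _ _); rewrite !exprS; ring.
move: (qpoch_inf (q ^+ 2) _) (qpoch_inf _ (- _)) (qpoch_inf _ (q * c * t
  * _)) (qpoch_inf _ _) => j1 j2 j3 j4.
rewrite (qpochSlE C q (- c) (- (c * q))); try ring.
rewrite (qpochSlE C (q ^+ 2) (q * c ^+ 2) (q * (c * q) ^+ 2)); try ring.
have -> : qpoch q (q * c ^+ 2) n.+1 = qpoch q (q * c ^+ 2) 2
   * qpoch q (q * (c * q) ^+ 2) n / qpoch q (q * c ^+ 2 * q ^+ n.+1) 1.
  apply: qpoch_swap; [by rewrite ?addn2 ?addn1 | | by ring].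
  apply: qpoch_neq0 => i; have [_ + _] := Hg (n.+1 + i)%N; congr (_ != _);
    rewrite exprD; ring.
have e : (1 - b * c) * qpoch q (b * (c * q)) n - qpoch q (b * c) n * (1 - b * c
  * q ^+ n) = 0.
  by rewrite -qpochSr (qpochSlE C q (b * c) (b * (c * q))) ?subrr //; ring.
move: e; rewrite !qpochSr !qpoch0 (exprAC q 2 n) (exprMn _ z) /z !exprS !expr0.
move: (q ^+ n) ((_ * _) ^+ n) (qpoch q (b * t) _) (qpoch q (b * (c
  * q)) _) (qpoch q (b * c) _)
  (qpoch (q * _) _ _) (qpoch _ (- _) _) (qpoch q q _) (qpoch q (q * _) _) =>
    X Z p1 p2 p3 p4 p5 p6 p7 e.
move=> h1 h2 h3 h4 h5 h6 h7 h8 h9.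
(* [(1 - b c) (b c q; q)_n] equals [(b c; q)_n (1 - b c q^n)], but 1 - b c may
   vanish: the difference of the two sides is a multiple of this relation. *)
apply/eqP; rewrite -subr_eq0; apply/eqP.
transitivity (- (1 + q * q * c * (t * t)) * (1 - b * c * c * t * q * q * X * X)
  * (j1 * j2 * ((1 - q * c * t * (q * X)) * j3) / j4)
  * (p1 * p4 * p5 / (p6 * p7)) * Z * ((1 - b * c) * p2 - p3 * (1 - b * c * X)));
    last first.
  by rewrite e mulr0.
field; nonzero.
Qed.

(** * Bounds and limits of the summands along c q^n *)

Lemma bounded2X (C : numFieldType) (u : nat -> nat -> C) m :
  bounded2 C u -> bounded2 C (fun n k => u n k ^+ m).
Proof.
move=> [K HK]; exists (K ^+ m) => n k; rewrite normrX.
by apply: lerXn2r; rewrite // nnegrE // (le_trans _ (HK n k)).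
Qed.

Lemma bounded2N (C : numFieldType) (u : nat -> nat -> C) :
  bounded2 C u -> bounded2 C (fun n k => - u n k).
Proof. by move=> [K HK]; exists K => n k; rewrite normrN. Qed.

Lemma bounded2_eq (C : numFieldType) (u v : nat -> nat -> C) :
  (forall n k, u n k = v n k) -> bounded2 C u -> bounded2 C v.
Proof. by move=> e [K HK]; exists K => n k; rewrite -e. Qed.

Lemma one_subXS_neq0 (C : numFieldType) (q : C) i : `|q| < 1 -> 1 - q * q ^+ i != 0.
Proof. by move=> q1; exact: one_subMX_neq0. Qed.

Lemma lcoef_bounded (C : numFieldType) (hC : geo_complete C) (q b c : C) :
  `|q| < 1 -> (forall n, 1 - q * c * q ^+ n != 0) ->
  bounded2 C (fun n k => lcoef C q b (c * q ^+ n) k).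
Proof.
move=> q1 Hc; rewrite /lcoef.
have bq := bounded2_exp C q (fun n _ => n) q1.
apply: bounded2M.
  apply: bounded2M; apply: bounded2_qpoch => //; last exact: bounded2_cst.
  by apply: bounded2M; [exact: bounded2_cst | apply: bounded2M => //;
    exact: bounded2_cst].
apply: (bounded2_eq C (fun n k =>
  (qpoch q (q * q ^+ 0) k)^-1 * (qpoch q (q * c * q ^+ n) k)^-1)).
  by move=> n k; rewrite invfM expr0 mulr1 mulrA.
apply: bounded2M.
  exact: (bounded2_qpochV C hC q q (fun _ _ => 0%N) (fun _ k => k) q1 (fun i =>
    one_subXS_neq0 C q i q1)).
exact: (bounded2_qpochV C hC q (q * c) (fun n _ => n) (fun _ k => k) q1 Hc).
Qed.

Lemma rcoef_bounded (C : numFieldType) (hC : geo_complete C) (q b c t : C) :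
  `|q| < 1 -> admissible C q b c t ->
  bounded2 C (fun n k => rcoef C q b (c * q ^+ n) t k).
Proof.
move=> q1 Hg; rewrite /rcoef.
have q21 : `|q ^+ 2| < 1 by rewrite normrX exprn_ilt1.
have bq := bounded2_exp C q (fun n _ => n) q1.
have bk := bounded2_exp C q (fun _ k => k) q1.
have cst := bounded2_cst C.
have bc : bounded2 C (fun n _ => c * q ^+ n) by exact: bounded2M.
have bc2 : bounded2 C (fun n _ => (c * q ^+ n) ^+ 2) by exact: bounded2X.
have bk2 : bounded2 C (fun _ k => (q ^+ k) ^+ 2) by exact: bounded2X.
have bb : bounded2 C (fun n k => b * (c * q ^+ n) * t * q ^+ k).
  by do !apply: bounded2M => //.
apply: bounded2M; first apply: bounded2M.
- by apply: bounded2_1B; do !apply: bounded2M => //.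
- apply: bounded2M; first (apply: bounded2M; first apply: bounded2M).
  + by apply: bounded2_qpoch_inf => //; apply: bounded2M => //; exact: bounded2X.
  + by apply: bounded2_qpoch_inf => //; apply: bounded2N; exact: bounded2M.
  + by apply: bounded2_qpoch_inf => //; do !apply: bounded2M => //.
  + apply: (bounded2_eq C (fun n k =>
    (qpoch_inf q (b * c ^+ 2 * t * q ^+ (n + n + k)))^-1)).
      by move=> n k; congr (_^-1); congr qpoch_inf; rewrite !exprD; ring.
    by apply: bounded2_qpoch_infV => // i; have [_ _] := Hg i.
- apply: bounded2M.
    do 3?apply: bounded2M.
    + exact: bounded2_qpoch.
    + by apply: bounded2_qpoch => //; exact: bounded2M.
    + by apply: bounded2_qpoch => //; exact: bounded2M.
    + by apply: bounded2_qpoch => //; exact: bounded2N.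
  apply: (bounded2_eq C (fun n k =>
    (qpoch q (q * q ^+ 0) k)^-1 * (qpoch q (q * c ^+ 2 * q ^+ (n + n)) k)^-1)).
    by move=> n k; rewrite expr0 mulr1 invfM; congr (_ * (qpoch _ _ _)^-1);
      rewrite exprD; ring.
  apply: bounded2M.
    exact: (bounded2_qpochV C hC q q (fun _ _ => 0%N) (fun _ k => k) q1 (fun i =>
      one_subXS_neq0 C q i q1)).
  apply: (bounded2_qpochV C hC q (q * c ^+ 2) (fun n _ => n + n)%N (fun _ k =>
    k) q1) => i.
  by have [_ ? _] := Hg i.
Qed.

Lemma cvg0Ml (C : numFieldType) (u : nat -> C) (a : C) :
  u @ \oo --> 0 -> (fun n => a * u n) @ \oo --> 0.
Proof.
by move=> u0; rewrite -[X in _ --> X](mulr0 a); apply: cvgM => //; exact: cvg_cst.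
Qed.

Lemma cvg0Mr (C : numFieldType) (u : nat -> C) (a : C) :
  u @ \oo --> 0 -> (fun n => u n * a) @ \oo --> 0.
Proof.
by move=> u0; rewrite -[X in _ --> X](mul0r a); apply: cvgM => //; exact: cvg_cst.
Qed.

Lemma lcoef_cvg (C : numFieldType) (hC : geo_complete C) (q b c : C) k :
  `|q| < 1 -> (fun n => lcoef C q b (c
    * q ^+ n) k) @ \oo --> qpoch q b k / qpoch q q k.
Proof.
move=> q1; rewrite /lcoef.
have y0 : (fun n => c * q ^+ n) @ \oo --> 0 by exact: (cvg_mul_geo0 C hC q c id).
have q0 : qpoch q q k != 0 by apply: qpoch_neq0 => i; exact: one_subXS_neq0.
have -> : qpoch q b k / qpoch q q k = 1 * qpoch q b k / (qpoch q q k * 1).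
  by rewrite mul1r mulr1.
apply: cvgM; first by apply: cvgM; [apply: cvg_qpoch1 => //;
  exact: cvg0Ml | exact: cvg_cst].
apply: cvgV; first by rewrite mulr1.
by apply: cvgM; [exact: cvg_cst | apply: cvg_qpoch1 => //; exact: cvg0Ml].
Qed.

(** All factors that contain c tend to 1; what remains is the q-binomial coefficient with parameter
    b t, instead of b on the other side. *)
Lemma rcoef_cvg (C : numFieldType) (hC : geo_complete C) (q b c t : C) k :
  `|q| < 1 -> (fun n => rcoef C q b (c * q ^+ n) t k) @ \oo -->
    qpoch q (b * t) k / qpoch q q k.
Proof.
move=> q1; rewrite /rcoef.
have q21 : `|q ^+ 2| < 1 by rewrite normrX exprn_ilt1.
have y0 : (fun n => c * q ^+ n) @ \oo --> 0 by exact: (cvg_mul_geo0 C hC q c id).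
have q0 : qpoch q q k != 0 by apply: qpoch_neq0 => i; exact: one_subXS_neq0.
have X2 (u : nat -> C) : u @ \oo --> 0 -> (fun n => u n ^+ 2) @ \oo --> 0.
  by move=> u0; rewrite -[X in _ --> X](mulr0 (0 : C)); exact: cvgM.
have A0 x : (fun n => b * (c * q ^+ n) ^+ 2 * t * x) @ \oo --> (0 : C).
  by do 2 apply: cvg0Mr; apply: cvg0Ml; exact: X2.
have b0 x : (fun n => b * (c * q ^+ n) * t * x) @ \oo --> (0 : C).
  by do 2 apply: cvg0Mr; exact: cvg0Ml.
have N0 (u : nat -> C) : u @ \oo --> 0 -> (fun n => - u n) @ \oo --> 0.
  by move=> u0; rewrite -[X in _ --> X]oppr0; exact: cvgN.
have -> : qpoch q (b * t) k / qpoch q q k =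
   (1 - 0) * (1 * 1 * 1 / 1) * (qpoch q (b * t) k * 1 * 1 * 1 / (qpoch q q k * 1)).
  by rewrite subr0 invr1 !mulr1 !mul1r.
apply: cvgM; first apply: cvgM.
- by apply: cvgB; [exact: cvg_cst | exact: A0].
- apply: cvgM; first (apply: cvgM; first apply: cvgM).
  + by apply: cvg_qpoch_inf1 => //; apply: cvg0Ml; exact: X2.
  + by apply: cvg_qpoch_inf1 => //; apply: N0; exact: cvg0Ml.
  + by apply: cvg_qpoch_inf1 => //; do 2 apply: cvg0Mr; exact: cvg0Ml.
  + by apply: cvgV; [exact: oner_neq0 | exact: cvg_qpoch_inf1].
- apply: cvgM.
    do 3?apply: cvgM.
    + exact: cvg_cst.
    + by apply: cvg_qpoch1 => //; exact: cvg0Ml.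
    + by apply: cvg_qpoch1 => //; apply: cvg0Ml; exact: X2.
    + by apply: cvg_qpoch1 => //; exact: N0.
  apply: cvgV; first by rewrite mulr1.
  apply: cvgM; first exact: cvg_cst.
  by apply: cvg_qpoch1 => //; apply: cvg0Ml; exact: X2.
Qed.

(** * The two sums and their contiguous relations *)

Definition lhs_series (C : numFieldType) (q b c t : C) : C :=
  limn (series (fun k => lcoef C q b c k * (q * t ^+ 2) ^+ k)).

(** The part of the prefactor that depends on q and t only and is not absorbed in [rcoef]. It is
    constant in the first relation and changes in the second, where t becomes t q. *)
Definition rhs_scale (C : numFieldType) (q t : C) : C :=
  qpoch_inf q (q * t) / qpoch_inf q (q * t ^+ 2).

Definition rhs_series (C : numFieldType) (q b c t : C) : C :=
  limn (series (fun k => rcoef C q b c t k * (q * t) ^+ k)).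

Definition defect (C : numFieldType) (q b c t : C) : C :=
  lhs_series C q b c t - rhs_scale C q t * rhs_series C q b c t.

Lemma normM_lt1 (C : numFieldType) (x y : C) : `|x| < 1 -> `|y| < 1 -> `|x * y| < 1.
Proof. by move=> x1 y1; rewrite normrM mulr_ilt1. Qed.

Lemma admissible_cqX (C : numFieldType) (q b c t : C) m :
  admissible C q b c t -> admissible C q b (c * q ^+ m) t.
Proof.
move=> Hg n; have [H1 _ _] := Hg (m + n)%N; have [_ H2 H3] := Hg (m + m + n)%N;
  split.
- by move: H1; congr (_ != _); rewrite exprD; ring.
- by move: H2; congr (_ != _); rewrite !exprD; ring.
- by move: H3; congr (_ != _); rewrite !exprD; ring.
Qed.

Lemma admissible_cq (C : numFieldType) (q b c t : C) :
  admissible C q b c t -> admissible C q b (c * q) t.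
Proof. by move/(admissible_cqX C q b c t 1); rewrite expr1. Qed.

Lemma admissible_bct (C : numFieldType) (q b c t : C) : q != 0 ->
  admissible C q b c t -> admissible C q (b / q) (c * q) (t * q).
Proof.
move=> q0 Hg n; have [H1 _ _] := Hg n.+1; have [_ H2 H3] := Hg n.+2; split.
- by move: H1; congr (_ != _); rewrite exprS; ring.
- by move: H2; congr (_ != _); rewrite !exprS; ring.
- by move: H3; congr (_ != _); rewrite !exprS; field.
Qed.

Lemma is_cvg_lhs_series (C : numFieldType) (hC : geo_complete C) (q b c t : C) :
  `|q| < 1 -> `|t| < 1 -> admissible C q b c t ->
  cvgn (series (fun k => lcoef C q b c k * (q * t ^+ 2) ^+ k)).
Proof.
move=> q1 t1 Hg.
have := cvg_series_bounded2 C hC _ (q * t ^+ 2) 0%N _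
  (lcoef_bounded C hC q b c q1 (fun n => let: And3 h _ _ := Hg n in h)).
by rewrite expr0 mulr1; apply; rewrite expr2 !normM_lt1.
Qed.

Lemma is_cvg_rhs_series (C : numFieldType) (hC : geo_complete C) (q b c t : C) :
  `|q| < 1 -> `|t| < 1 -> admissible C q b c t ->
  cvgn (series (fun k => rcoef C q b c t k * (q * t) ^+ k)).
Proof.
move=> q1 t1 Hg.
have := cvg_series_bounded2 C hC _ (q * t) 0%N _ (rcoef_bounded C hC q b c t q1 Hg).
by rewrite expr0 mulr1; apply; rewrite normM_lt1.
Qed.

Lemma cvg_bounded2_0 (C : numFieldType) (hC : geo_complete C) (u : nat ->
  C) (z : C) :
  `|z| < 1 -> bounded2 C (fun _ => u) -> (fun n => u n * z ^+ n) @ \oo --> 0.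
Proof.
move=> z1 bu; apply: cvg_series_cvg_0.
exact: (cvg_series_bounded2 C hC (fun _ => u) z 0%N).
Qed.

Lemma lhs_series_rec_c (C : numFieldType) (hC : geo_complete C) (q b c t : C) :
  `|q| < 1 -> `|t| < 1 -> admissible C q b c t ->
  (1 - q * c) * (1 - q ^+ 2 * c) * lhs_series C q b c t
  + - ((1 - q * c) * (1 - q ^+ 2 * c) * (1
    + b * t ^+ 2)) * lhs_series C q b (c * q) t
  + t ^+ 2 * (b - q ^+ 2 * c) * (1 - b * c * q) * lhs_series C q b (c
    * q ^+ 2) t = 0.
Proof.
move=> q1 t1 Hg; rewrite /lhs_series.
have c0 := is_cvg_lhs_series C hC q b c t q1 t1 Hg.
have c1 := is_cvg_lhs_series C hC q b _ t q1 t1 (admissible_cq C q b c t Hg).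
have c2 := is_cvg_lhs_series C hC q b _ t q1 t1 (admissible_cqX C q b c t 2 Hg).
rewrite -!limn_seriesM //.
have Hc n : 1 - q * c * q ^+ n != 0 by have [] := Hg n.
apply: (telescope_lim C _ _ _ _ 2 1 0 _ _ _ _ (fun n =>
  lcoef_rec_c C q b c t n q1 Hc)).
- exact: cvgn_seriesM.
- exact: cvgn_seriesM.
- exact: cvgn_seriesM.
(* The rational factor has the limit 1, and the terms of a convergent series tend to 0. *)
- rewrite /=; apply: (@cvg_trans _ _ _ _ (_ : _ --> (t ^+ 2 * (q - b) * (1 - b
  * c * q) * ((1 - 0) / (1 - 0))) * 0)); last by rewrite mulr0.
  apply: cvgM; last exact: cvg_series_cvg_0.
  apply: cvgM; first exact: cvg_cst.
  have g0 x : (fun n => x * q ^+ n) @ \oo --> (0 : C) by exact: (cvg_mul_geo0 C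
    hC q x id).
  apply: cvgM; first by apply: cvgB; [exact: cvg_cst | exact: g0].
  by apply: cvgV; [rewrite subr0 oner_neq0 | apply: cvgB;
    [exact: cvg_cst | exact: g0]].
(* The shifts 2, 1, 0 leave out the indices 0 and 1 at c and the index 0 at c q; these terms sum to
   G 0. *)
rewrite /series /= !big_nat_recr //= !big_geq // /lcoef !qpochSr !qpoch0 !expr0.
have h0 := Hc 0%N; have h1 := Hc 1%N; have h2 := one_subXS_neq0 C q 0 q1.
move: h0 h1 h2; rewrite !exprS !expr0 => h0 h1 h2.
field; nonzero.
Qed.

Lemma rhs_series_rec_c (C : numFieldType) (hC : geo_complete C) (q b c t : C) :
  `|q| < 1 -> `|t| < 1 -> admissible C q b c t ->
  (1 - q * c) * (1 - q ^+ 2 * c) * rhs_series C q b c t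
  + - ((1 - q * c) * (1 - q ^+ 2 * c) * (1
    + b * t ^+ 2)) * rhs_series C q b (c * q) t
  + t ^+ 2 * (b - q ^+ 2 * c) * (1 - b * c * q) * rhs_series C q b (c
    * q ^+ 2) t = 0.
Proof.
move=> q1 t1 Hg; rewrite /rhs_series.
have c0 := is_cvg_rhs_series C hC q b c t q1 t1 Hg.
have c1 := is_cvg_rhs_series C hC q b _ t q1 t1 (admissible_cq C q b c t Hg).
have c2 := is_cvg_rhs_series C hC q b _ t q1 t1 (admissible_cqX C q b c t 2 Hg).
rewrite -!limn_seriesM //.
apply: (telescope_lim C _ _ _ _ 2 1 0 _ _ _ _ (fun n =>
  rcoef_rec_c C hC q b c t n q1 Hg)).
- exact: cvgn_seriesM.
- exact: cvgn_seriesM.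
- exact: cvgn_seriesM.
- have q21 : `|q ^+ 2| < 1 by rewrite normrX exprn_ilt1.
  have cst := bounded2_cst C.
  have bk0 : bounded2 C (fun _ n =>
    q ^+ n) by exact: (bounded2_exp C q (fun _ n => n) q1).
  have bk1 : bounded2 C (fun _ n =>
    q ^+ n.+1) by exact: (bounded2_exp C q (fun _ n => n.+1) q1).
  (* This certificate is a bounded sequence times (q t)^n, so it tends to 0 whether or not the
     bounded factor converges. *)
  rewrite /=; apply: (cvg_bounded2_0 C hC); first by rewrite normM_lt1.
  apply: bounded2M; first apply: bounded2M; first apply: bounded2M;
    first exact: cst.
  + apply: bounded2M; first by apply: bounded2_1B; exact: bounded2M.
    apply: (bounded2_eq C (fun _ n => (qpoch q (q * q ^+ n) 1)^-1)).
      by move=> _ n; rewrite qpochSr qpoch0 mul1r expr0 mulr1.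
    exact: (bounded2_qpochV C hC q q (fun _ n => n) (fun _ _ => 1%N) q1 (fun i =>
      one_subXS_neq0 C q i q1)).
  + apply: bounded2M; first (apply: bounded2M; first apply: bounded2M).
    * by apply: bounded2_qpoch_inf => //; apply: bounded2M => //;
      apply: bounded2X; exact: bounded2M.
    * by apply: bounded2_qpoch_inf => //; apply: bounded2N;
      apply: bounded2M => //; exact: bounded2M.
    * by apply: bounded2_qpoch_inf => //; exact: bounded2M.
    * apply: (bounded2_qpoch_infV C hC q (b * c ^+ 2 * t) (fun _ n =>
      n.+2) q1) => i.
      by have [_ _] := Hg i.
  + apply: bounded2M.
      by do 3?apply: bounded2M; exact: bounded2_qpoch.
    apply: (bounded2_eq C (fun _ n =>
      (qpoch q (q * q ^+ 0) n)^-1 * (qpoch q (q * c ^+ 2 * q ^+ 4) n)^-1)).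
      move=> _ n; rewrite expr0 mulr1 invfM; congr (_ * (qpoch _ _ _)^-1); ring.
    apply: bounded2M.
      exact: (bounded2_qpochV C hC q q (fun _ _ => 0%N) (fun _ k =>
        k) q1 (fun i => one_subXS_neq0 C q i q1)).
    apply: (bounded2_qpochV C hC q (q * c ^+ 2) (fun _ _ => 4) (fun _ k =>
      k) q1) => i.
    by have [_ ? _] := Hg i.
rewrite /series /= !big_nat_recr //= !big_geq // /rcoef.
have q21 : `|q ^+ 2| < 1 by rewrite normrX exprn_ilt1.
rewrite (_ : b * (c * q) * t * q ^+ 0 = b * c * t * q ^+ 1); last by ring.
rewrite (_ : q * (c * q) * t * q ^+ 0 = q * c * t * q ^+ 1); last by ring.
rewrite (_ : b * (c * q) ^+ 2 * t * q ^+ 0 = b * c ^+ 2 * t * q ^+ 2); last by ring.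
have i4 k : qpoch_inf q (b * c ^+ 2 * t * q ^+ k) =
    (1 - b * c ^+ 2 * t * q ^+ k) * qpoch_inf q (b * c ^+ 2 * t * q ^+ k.+1).
  by rewrite (qpoch_infS C hC) // [q ^+ k.+1]exprSr mulrA.
rewrite (i4 0%N) (i4 1%N).
have -> : qpoch_inf q (q * c * t * q ^+ 0) =
   (1 - q * c * t * q ^+ 0) * qpoch_inf q (q * c * t * q ^+ 1).
  by rewrite (qpoch_infS C hC) // [q ^+ 1]exprSr mulrA.
have -> : qpoch_inf q (- (q * (b * c * t * q ^+ 0))) =
   (1 + (q * (b * c * t * q ^+ 0))) * qpoch_inf q (- (q * (b * c * t * q ^+ 1))).
  by rewrite (qpoch_infS C hC) // opprK [q ^+ 1]exprSr mulNr !mulrA.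
have -> : qpoch_inf (q ^+ 2) (q * (b * c * t * q ^+ 0) ^+ 2) =
   (1 - (q * (b * c * t * q ^+ 0) ^+ 2)) * qpoch_inf (q ^+ 2) (q * (b * c * t
     * q ^+ 1) ^+ 2).
  rewrite (qpoch_infS C hC) //; congr (_ * qpoch_inf _ _); ring.
have : qpoch_inf q (b * c ^+ 2 * t * q ^+ 2) != 0.
  apply: qpoch_inf_neq0 => // i; have [_ _] := Hg (2 + i)%N; congr (_ != _);
    rewrite exprD; ring.
have [_ h _] := Hg 0%N; move: h; have [_ h _] := Hg 1%N; move: h;
  have [_ h _] := Hg 3%N; move: h.
have [_ _ h] := Hg 0%N; move: h; have [_ _ h] := Hg 1%N; move: h;
  have := one_subXS_neq0 C q 0 q1.
rewrite !qpochSr !qpoch0 !exprS !expr0.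
move: (qpoch_inf _ _) (qpoch_inf _ _) (qpoch_inf _ _) (qpoch_inf _ _) =>
  j1 j2 j3 j4.
move=> h1 h2 h3 h4 h5 h6 h7.
field.
nonzero.
Qed.

Lemma lhs_series_rec_bct (C : numFieldType) (hC : geo_complete C) (q b c t : C) :
  `|q| < 1 -> q != 0 -> `|t| < 1 -> admissible C q b c t ->
  (1 - q ^+ 2 * c ^+ 2) * lhs_series C q b c t
  + - ((1 - b * c) * (1 + q ^+ 2 * c * t ^+ 2)) * lhs_series C q b (c * q) t
  + c * (q ^+ 2 * c - b) * lhs_series C q (b / q) (c * q) (t * q) = 0.
Proof.
move=> q1 q0 t1 Hg; rewrite /lhs_series.
have c0 := is_cvg_lhs_series C hC q b c t q1 t1 Hg.
have c1 := is_cvg_lhs_series C hC q b _ t q1 t1 (admissible_cq C q b c t Hg).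
have c2 := is_cvg_lhs_series C hC q _ _ _ q1 (normM_lt1 C _ _ t1 q1)
  (admissible_bct C q b c t q0 Hg).
rewrite -!limn_seriesM //.
have Hc n : 1 - q * c * q ^+ n != 0 by have [] := Hg n.
apply: (telescope_lim C _ _ _ _ 1 0 1 _ _ _ _ (fun n =>
  lcoef_rec_bct C q b c t n q1 q0 Hc)).
- exact: cvgn_seriesM.
- exact: cvgn_seriesM.
- exact: cvgn_seriesM.
- by apply: cvg0Ml; exact: cvg_series_cvg_0.
(* The omitted terms have index 0, and (1 - q^2 c^2) + c (q^2 c - b) = 1 - b c is G 0. *)
rewrite /series /= !big_nat_recr //= !big_geq // /lcoef !qpoch0 !expr0.
by field.
Qed.

Lemma rhs_series_rec_bct (C : numFieldType) (hC : geo_complete C) (q b c t : C) :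
  `|q| < 1 -> q != 0 -> `|t| < 1 -> admissible C q b c t ->
  (1 - q ^+ 2 * c ^+ 2) * rhs_series C q b c t
  + - ((1 - b * c) * (1 + q ^+ 2 * c * t ^+ 2)) * rhs_series C q b (c * q) t
  + c * (q ^+ 2 * c - b) * ((1 - q * t ^+ 2) * (1 + q * t))
    * rhs_series C q (b / q) (c * q) (t * q) = 0.
Proof.
move=> q1 q0 t1 Hg; rewrite /rhs_series.
have c0 := is_cvg_rhs_series C hC q b c t q1 t1 Hg.
have c1 := is_cvg_rhs_series C hC q b _ t q1 t1 (admissible_cq C q b c t Hg).
have c2 := is_cvg_rhs_series C hC q _ _ _ q1 (normM_lt1 C _ _ t1 q1)
  (admissible_bct C q b c t q0 Hg).
rewrite -!limn_seriesM //.
apply: (telescope_lim C _ _ _ _ 1 0 0 _ _ _ _ (fun n =>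
  rcoef_rec_bct C hC q b c t n q1 q0 Hg)).
- exact: cvgn_seriesM.
- exact: cvgn_seriesM.
- exact: cvgn_seriesM.
- have q21 : `|q ^+ 2| < 1 by rewrite normrX exprn_ilt1.
  have cst := bounded2_cst C.
  have bk0 : bounded2 C (fun _ n =>
    q ^+ n) by exact: (bounded2_exp C q (fun _ n => n) q1).
  have bk1 : bounded2 C (fun _ n =>
    q ^+ n.+1) by exact: (bounded2_exp C q (fun _ n => n.+1) q1).
  rewrite /=; apply: (cvg_bounded2_0 C hC); first by rewrite normM_lt1.
  apply: bounded2M; first apply: bounded2M; first apply: bounded2M;
    first exact: cst.
  + by apply: bounded2_1B; exact: bounded2M.
  + apply: bounded2M; first (apply: bounded2M; first apply: bounded2M).
    * by apply: bounded2_qpoch_inf => //; apply: bounded2M => //;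
      apply: bounded2X; exact: bounded2M.
    * by apply: bounded2_qpoch_inf => //; apply: bounded2N;
      apply: bounded2M => //; exact: bounded2M.
    * by apply: bounded2_qpoch_inf => //; exact: bounded2M.
    * apply: (bounded2_qpoch_infV C hC q (b * c ^+ 2 * t) (fun _ n =>
      n.+1) q1) => i.
      by have [_ _] := Hg i.
  + apply: bounded2M.
      by do 3?apply: bounded2M; exact: bounded2_qpoch.
    apply: (bounded2_eq C (fun _ n =>
      (qpoch q (q * q ^+ 0) n)^-1 * (qpoch q (q * c ^+ 2 * q ^+ 2) n)^-1)).
      move=> _ n; rewrite expr0 mulr1 invfM; congr (_ * (qpoch _ _ _)^-1); ring.
    apply: bounded2M.
      exact: (bounded2_qpochV C hC q q (fun _ _ => 0%N) (fun _ k =>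
        k) q1 (fun i => one_subXS_neq0 C q i q1)).
    apply: (bounded2_qpochV C hC q (q * c ^+ 2) (fun _ _ => 2) (fun _ k =>
      k) q1) => i.
    by have [_ ? _] := Hg i.
rewrite /series /= !big_nat_recr //= !big_geq // /rcoef.
have -> : qpoch_inf q (b * c ^+ 2 * t * q ^+ 0) =
    (1 - b * c ^+ 2 * t * q ^+ 0) * qpoch_inf q (b * c ^+ 2 * t * q ^+ 1).
  by rewrite (qpoch_infS C hC) // [q ^+ 1]exprSr mulrA.
have -> : qpoch_inf q (q * c * t * q ^+ 0) =
   (1 - q * c * t * q ^+ 0) * qpoch_inf q (q * c * t * q ^+ 1).
  by rewrite (qpoch_infS C hC) // [q ^+ 1]exprSr mulrA.
have : qpoch_inf q (b * c ^+ 2 * t * q ^+ 1) != 0.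
  apply: qpoch_inf_neq0 => // i; have [_ _] := Hg (1 + i)%N; congr (_ != _);
    rewrite exprD; ring.
have [_ _ h] := Hg 0%N; move: h.
rewrite !qpoch0 !exprS !expr0.
move: (qpoch_inf _ _) (qpoch_inf _ _) (qpoch_inf _ _) (qpoch_inf _ _) =>
  j1 j2 j3 j4 h1 h2.
field; nonzero.
Qed.

(** * Vanishing of the difference of the two sides *)

Lemma defect_rec_c (C : numFieldType) (hC : geo_complete C) (q b c t : C) :
  `|q| < 1 -> `|t| < 1 -> admissible C q b c t ->
  (1 - q * c) * (1 - q ^+ 2 * c) * (defect C q b c t
    - (1 + b * t ^+ 2) * defect C q b (c * q) t)
  + t ^+ 2 * (b - q ^+ 2 * c) * (1 - b * c * q) * defect C q b (c * q ^+ 2) t = 0.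
Proof.
move=> q1 t1 Hg; have hl := lhs_series_rec_c C hC q b c t q1 t1 Hg.
have hr := rhs_series_rec_c C hC q b c t q1 t1 Hg.
rewrite -[RHS](subrr 0) -{1}hl -[in RHS](mulr0 (rhs_scale C q t)) -hr /defect; ring.
Qed.

Lemma defect_rec_bct (C : numFieldType) (hC : geo_complete C) (q b c t : C) :
  `|q| < 1 -> q != 0 -> `|t| < 1 -> admissible C q b c t ->
  (1 - q ^+ 2 * c ^+ 2) * defect C q b c t
  - (1 - b * c) * (1 + q ^+ 2 * c * t ^+ 2) * defect C q b (c * q) t
  + c * (q ^+ 2 * c - b) * defect C q (b / q) (c * q) (t * q) = 0.
Proof.
move=> q1 q0 t1 Hg; have hl := lhs_series_rec_bct C hC q b c t q1 q0 t1 Hg.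
have hr := rhs_series_rec_bct C hC q b c t q1 q0 t1 Hg.
have t21 : `|q * t ^+ 2| < 1 by rewrite expr2 !normM_lt1.
have qt1 : `|q * t| < 1 by rewrite normM_lt1.
(* Here (1 - q^2 t^2) / (1 - q t) = 1 + q t. This ratio is the extra factor in the third term of
   [rhs_series_rec_bct], so after scaling both sides satisfy the same relation. *)
have W : rhs_scale C q (t * q) = rhs_scale C q t * ((1 - q * t ^+ 2) * (1 + q * t)).
  rewrite /rhs_scale (qpoch_infS C hC q (q * t)) // (qpoch_infS C hC q (q
    * t ^+ 2)) //.
  rewrite (qpoch_infS C hC q (q * t ^+ 2 * q)) //.
  rewrite (_ : q * (t * q) = q * t * q); last by ring.
  rewrite (_ : q * (t * q) ^+ 2 = q * t ^+ 2 * q * q); last by ring.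
  have : qpoch_inf q (q * t ^+ 2 * q * q) != 0.
    apply: qpoch_inf_neq0 => // i; apply: one_subMX_neq0 => //.
    by rewrite !(normM_lt1 C _ q).
  have h1 := one_subMX_neq0 C _ q 0 t21 q1.
  have h2 := one_subMX_neq0 C _ q 1 t21 q1.
  have h3 := one_subMX_neq0 C _ q 0 qt1 q1.
  move: h1 h2 h3; rewrite !expr0.
  move: (qpoch_inf _ _) (qpoch_inf _ _) => j1 j2 h1 h2 h3 h4.
  field; nonzero.
rewrite -[RHS](subrr 0) -{1}hl -[in RHS](mulr0 (rhs_scale C q t)) -hr /defect W;
  ring.
Qed.

Lemma defect_cvg0 (C : numFieldType) (hC : geo_complete C) (q b c t : C) :
  `|q| < 1 -> `|t| < 1 -> admissible C q b c t ->
  (fun n => defect C q b (c * q ^+ n) t) @ \oo --> 0.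
Proof.
move=> q1 t1 Hg.
have t21 : `|q * t ^+ 2| < 1 by rewrite expr2 !normM_lt1.
have qt1 : `|q * t| < 1 by rewrite normM_lt1.
have Hc n : 1 - q * c * q ^+ n != 0 by have [] := Hg n.
have -> : 0 = limn (series (fun k => qpoch q b k / qpoch q q k * (q * t ^+ 2) ^+ k))
   - rhs_scale C q t * limn (series (fun k =>
     qpoch q (b * t) k / qpoch q q k * (q * t) ^+ k)).
  (* The two sums are (b q t^2; q)_oo over (q t^2; q)_oo and over (q t; q)_oo; [rhs_scale] exchanges
     these denominators. *)
  rewrite !q_binomial // /rhs_scale (_ : b * t * (q * t) = b * (q * t ^+ 2));
    last by ring.
  have : qpoch_inf q (q * t) != 0.
    by apply: qpoch_inf_neq0 => // i; exact: one_subMX_neq0.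
  have : qpoch_inf q (q * t ^+ 2) != 0.
    by apply: qpoch_inf_neq0 => // i; exact: one_subMX_neq0.
  by move=> h1 h2; field; nonzero.
apply: cvgB; last apply: cvgM; last 2 first.
- exact: cvg_cst.
- apply: (tannery C hC (fun n k => rcoef C q b (c * q ^+ n) t k)) => //.
  + exact: rcoef_bounded.
  + by move=> k; exact: rcoef_cvg.
- apply: (tannery C hC (fun n k => lcoef C q b (c * q ^+ n) k)) => //.
  + exact: lcoef_bounded.
  + by move=> k; exact: lcoef_cvg.
Qed.

(* E n = D n - D n.+1 satisfies E n = w E n.+1 + O(r^n D), so |D| <= S beyond N
   implies |D n| <= K r^n S there; for N large this halves S, hence D vanishes
   beyond N, and the recurrence carries this down to 0. *)
Lemma recurrence_eq0 (C : numFieldType) (hC : geo_complete C) (D s : nat ->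
  C) (w M r : C) :
  `|w| < 1 -> 0 <= r -> r < 1 -> D @ \oo --> 0 ->
  (forall n, `|s n - w| <= M * r ^+ n) ->
  (forall n, D n = (1 + w) * D n.+1 - s n * D n.+2) -> D 0%N = 0.
Proof.
move=> w1 r0 r1 D0 sw rec.
have w10 : 0 < 1 - `|w| by rewrite subr_gt0.
have r10 : 0 < 1 - r by rewrite subr_gt0.
have M0 : 0 <= M by have := sw 0%N; rewrite expr0 mulr1; exact: le_trans.
pose E n := D n - D n.+1.
have recE n : E n = w * E n.+1 - (s n - w) * D n.+2 by rewrite /E rec; ring.
(* The factor 1 / (1 - |w|) comes from solving the recurrence for E, and 1 / (1 - r) from summing E
   back to D. *)
pose K := M / (1 - `|w|) / (1 - r).
have rle n i : r ^+ (n + i) <= r ^+ n.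
  by rewrite exprD ler_piMr ?exprn_ge0 // exprn_ile1 // ltW.
have shift0 n : (fun j => D (n + j)%N) @ \oo --> 0.
  have -> : (fun j => D (n + j)%N) = (fun j => D (j + n)%N).
    by apply/funext => j; rewrite addnC.
  by have := D0; rewrite -{1}(cvg_shiftn n D).
have step N S : (forall k, (N <= k)%N -> `|D k| <= S) ->
    forall n, (N <= n)%N -> `|D n| <= K * r ^+ n * S.
  move=> HS n Nn.
  have S0 : 0 <= S := le_trans (normr_ge0 _) (HS N (leqnn N)).
  have HE m : (N <= m)%N -> `|E m| <= M / (1 - `|w|) * r ^+ m * S.
    move=> Nm.
    (* This difference telescopes into the perturbations (s - w) D, and the remainder w^j E (m + j)
       tends to 0. *)
    have cE : (fun j => E m - w ^+ j * E (m + j)%N) @ \oo --> E m.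
      rewrite -[X in _ --> X]subr0 -[X in _ --> _ - X](mulr0 0).
      apply: cvgB; first exact: cvg_cst.
      apply: cvgM; first exact: (cvg_geo0 C hC).
      rewrite -[X in _ --> X](subrr 0); apply: cvgB; first exact: shift0.
      exact: (shift0 m.+1).
    rewrite -[E m]subr0; apply: (cvg_dist_le C _ _ _ _ 0 cE) => j _; rewrite subr0.
    have : `|E m - w ^+ j * E (m + j)%N| <= M * r ^+ m * S
      * (1 - `|w| ^+ j) / (1 - `|w|).
      elim: j => [|j IH].
        by rewrite addn0 !expr0 mul1r !subrr normr0 mulr0 mul0r.
      have -> : E m - w ^+ j.+1 * E (m + j.+1)%N =
         E m - w ^+ j * E (m + j)%N - w ^+ j * ((s (m + j)%N - w) * D (m + j).+2).
        by rewrite (recE (m + j)%N) addnS exprS; ring.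
      apply: le_trans (ler_normB _ _) _.
      have -> : M * r ^+ m * S * (1 - `|w| ^+ j.+1) / (1 - `|w|) =
        M * r ^+ m * S * (1 - `|w| ^+ j) / (1 - `|w|)
          + `|w| ^+ j * (M * r ^+ m * S).
        by rewrite exprS; field; rewrite gt_eqF.
      apply: lerD => //; rewrite normrM normrX; apply: ler_wpM2l;
        first exact: exprn_ge0.
      rewrite normrM; apply: ler_pM => //.
        by apply: le_trans (sw _) _; apply: ler_wpM2l.
      by apply: HS; rewrite -addnS -addSn (leq_trans Nm) // addSn -addnS leq_addr.
    move=> /le_trans; apply.
    have -> : M / (1 - `|w|) * r ^+ m * S = M * r ^+ m * S / (1 - `|w|).
      by field; rewrite gt_eqF.
    rewrite ler_pM2r ?invr_gt0 // ler_piMr ?gerBl ?exprn_ge0 //.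
    by rewrite !mulr_ge0 ?exprn_ge0.
  have cD : (fun j => D n - D (n + j)%N) @ \oo --> D n.
    by rewrite -[X in _ --> X]subr0; apply: cvgB; [exact: cvg_cst | exact: shift0].
  rewrite -[D n]subr0; apply: (cvg_dist_le C _ _ _ _ 0 cD) => j _; rewrite subr0.
  have : `|D n - D (n + j)%N| <= M / (1 - `|w|) * r ^+ n * S
    * (1 - r ^+ j) / (1 - r).
    elim: j => [|j IH]; first by rewrite addn0 expr0 !subrr normr0 mulr0 mul0r.
    have -> : D n - D (n + j.+1)%N = D n - D (n + j)%N + E (n + j)%N.
      by rewrite /E addnS; ring.
    apply: le_trans (ler_normD _ _) _.
    have -> : M / (1 - `|w|) * r ^+ n * S * (1 - r ^+ j.+1) / (1 - r) =
       M / (1 - `|w|) * r ^+ n * S * (1 - r ^+ j) / (1 - r)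
         + M / (1 - `|w|) * r ^+ (n + j) * S.
      by rewrite exprS exprD; field; rewrite !gt_eqF.
    by apply: lerD => //; apply: HE; exact: leq_trans (leq_addr _ _).
  move=> /le_trans; apply; rewrite /K.
  have -> : M / (1 - `|w|) / (1 - r) * r ^+ n * S = M / (1 - `|w|) * r ^+ n
    * S / (1 - r).
    by field; rewrite !gt_eqF.
  rewrite ler_pM2r ?invr_gt0 // ler_piMr ?gerBl ?exprn_ge0 //.
  by rewrite !mulr_ge0 ?invr_ge0 ?exprn_ge0 ?(ltW w10).
have K0 : 0 <= K by rewrite /K !mulr_ge0 ?invr_ge0 ?(ltW w10) ?(ltW r10).
have [N HN1 HN2] : exists2 N, K * r ^+ N <= 2^-1 & forall k,
  (N <= k)%N -> `|D k| <= 1.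
  have /cvgr0Pnorm_lt/(_ 2^-1) : (fun n => K * r ^+ n) @ \oo --> 0.
    by apply: cvg0Ml; apply: (cvg_geo0 C hC); rewrite ger0_norm.
  rewrite invr_gt0 ltr0n => /(_ isT) [N1 _ H1].
  move/cvgr0Pnorm_lt : D0 => /(_ 1 ltr01) [N2 _ H2].
  exists (maxn N1 N2).
    have := ltW (H1 (maxn N1 N2) (leq_maxl _ _)); rewrite /= ger0_norm //.
    by rewrite mulr_ge0 ?exprn_ge0.
  by move=> k; rewrite geq_max => /andP[_ /H2/ltW].
have half i : forall k, (N <= k)%N -> `|D k| <= 2^-1 ^+ i.
  elim: i => [|i IH] k Nk; first by rewrite expr0 HN2.
  apply: le_trans (step N _ IH k Nk) _; rewrite exprS; apply: ler_wpM2r.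
    by rewrite exprn_ge0 // invr_ge0.
  apply: le_trans HN1; apply: ler_wpM2l => //.
  by rewrite -(subnKC Nk) rle.
have DN k : (N <= k)%N -> D k = 0.
  move=> Nk; apply/eqP; rewrite -normr_le0; apply/ler_addgt0Pr => e e0;
    rewrite add0r.
  have : `|2^-1 : C| < 1 by rewrite ger0_norm ?invr_ge0 // invf_lt1 // ltr1n.
  move/(cvg_geo0 C hC)/cvgr0Pnorm_lt => /(_ e e0) [i _ /(_ i (leqnn i)) /= Hi].
  apply: le_trans (half i k Nk) _; apply: ltW; apply: le_lt_trans Hi.
  by rewrite ger0_norm // exprn_ge0 // invr_ge0.
(* The recurrence gives D k from the next two values without division by s, so zeros propagate
   downwards. *)
have back j : forall k, (N <= k + j)%N -> D k = 0.
  elim: j => [|j IH] k; first by rewrite addn0; exact: DN.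
  rewrite addnS -addSn => Nk; rewrite rec !IH ?mulr0 ?subr0 //.
  by rewrite addSn; exact: leqW.
by apply: (back N); rewrite add0n.
Qed.

Lemma defect_eq0_small (C : numFieldType) (hC : geo_complete C) (q b c t : C) :
  `|q| < 1 -> `|t| < 1 -> `|b * t ^+ 2| < 1 -> admissible C q b c t ->
  defect C q b c t = 0.
Proof.
move=> q1 t1 w1 Hg.
have Hd n : 1 - q * c * q ^+ n != 0 by have [] := Hg n.
have [K HK] := bounded2M C _ _ (bounded2_cst C (t ^+ 2 * q * (1 - b) * (b - q) * c))
  (bounded2_qpochV C hC q (q * c) (fun n _ => n) (fun _ _ => 2%N) q1 Hd).
pose s n := t ^+ 2 * (b - q ^+ 2 * (c * q ^+ n)) * (1 - b * (c * q ^+ n) * q)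
  / ((1 - q * (c * q ^+ n)) * (1 - q ^+ 2 * (c * q ^+ n))).
have nz1 n : 1 - q * (c * q ^+ n) != 0 by move: (Hd n); congr (_ != _); ring.
have nz2 n : 1 - q ^+ 2 * (c * q ^+ n) != 0.
  by move: (Hd n.+1); congr (_ != _); rewrite exprS; ring.
have := recurrence_eq0 C hC (fun n =>
  defect C q b (c * q ^+ n) t) s (b * t ^+ 2) K `|q|
  w1 (normr_ge0 _) q1 (defect_cvg0 C hC q b c t q1 t1 Hg).
rewrite expr0 mulr1; apply => n.
  (* Over the common denominator, the terms of degree 0 and 2 in c cancel. The remaining term,
     linear in c, supplies both the factor q^n and the constant bounded by K. *)
  have -> : s n - b * t ^+ 2 = t ^+ 2 * q * (1 - b) * (b - q) * c
     * (qpoch q (q * c * q ^+ n) 2)^-1 * q ^+ n.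
    rewrite /s !qpochSr qpoch0 expr0 expr1; field.
    have := nz1 n; have := nz2 n => h1 h2; nonzero.
  by rewrite normrM normrX; apply: ler_wpM2r;
    [exact: exprn_ge0 | exact: (HK n 0%N)].
have := defect_rec_c C hC q b (c * q ^+ n) t q1 t1 (admissible_cqX C q b c t n Hg).
rewrite (_ : c * q ^+ n * q = c * q ^+ n.+1); last by rewrite exprSr mulrA.
rewrite (_ : c * q ^+ n * q ^+ 2 = c * q ^+ n.+2) => [H|];
  last by rewrite !exprS; ring.
have H0 := nz1 n; have H1 := nz2 n.
apply/eqP; rewrite -subr_eq0; apply/eqP.
rewrite -[RHS](mulr0 ((1 - q * (c * q ^+ n)) * (1 - q ^+ 2 * (c
  * q ^+ n)))^-1) -H /s.
field; nonzero.
Qed.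

(** With its third term zero, the second relation iterates to (q^2 c^2; q^2)_n D(c) = (b c; q)_n (-
    q^2 c t^2; q)_n D(c q^n), where D is the defect as a function of c. The right-hand side tends to
    0 and the product on the left has a nonzero limit. *)
Lemma defect_eq0 (C : numFieldType) (hC : geo_complete C) (q b c t : C) :
  `|q| < 1 -> q != 0 -> `|t| < 1 -> admissible C q b c t -> defect C q b c t = 0.
Proof.
move=> q1 q0 t1 Hg.
have [m] : exists m, `|b * t ^+ 2 * q ^+ m| < 1.
  have /cvgr0Pnorm_lt/(_ 1 ltr01)[m _ /(_ m (leqnn m)) Hm] := cvg_mul_geo0 C hC q
    (b * t ^+ 2) id q1 (fun n => leqnn n).
  by exists m.
(* The induction hypothesis is applied at (b/q, c q^(n+1), t q) for every n, hence the
   generalization. *)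
elim: m b c t t1 Hg => [|m IH] b c t t1 Hg.
  by rewrite expr0 mulr1 => w1; exact: defect_eq0_small.
move=> wm.
have Y n : (1 - q ^+ 2 * (c * q ^+ n) ^+ 2) * defect C q b (c * q ^+ n) t =
   (1 - b * (c * q ^+ n)) * (1 + q ^+ 2 * (c * q ^+ n) * t ^+ 2)
     * defect C q b (c * q ^+ n.+1) t.
  have Hn := admissible_cqX C q b c t n Hg.
  have := defect_rec_bct C hC q b _ t q1 q0 t1 Hn.
  rewrite (IH (b / q)) ?mulr0 ?addr0; last 3 first.
  - by rewrite normM_lt1.
  - exact: admissible_bct.
  - by move: wm; congr (`|_| < 1); rewrite [q ^+ m.+1]exprS; field.
  by move/eqP; rewrite subr_eq0 => /eqP ->;
    rewrite [q ^+ n.+1]exprSr [c * (_ * _)]mulrA.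
have q21 : `|q ^+ 2| < 1 by rewrite normrX exprn_ilt1.
have it n : qpoch (q ^+ 2) (q ^+ 2 * c ^+ 2) n * defect C q b c t =
  qpoch q (b * c) n * qpoch q (- (q ^+ 2 * c * t ^+ 2)) n * defect C q b (c
    * q ^+ n) t.
  elim: n => [|n IHn]; first by rewrite !qpoch0 expr0 !mulr1 !mul1r.
  rewrite !qpochSr mulrAC IHn.
  rewrite (_ : q ^+ 2 * c ^+ 2 * q ^+ 2 ^+ n = q ^+ 2 * (c * q ^+ n) ^+ 2);
    last first.
    by rewrite exprAC; ring.
  by rewrite -[LHS]mulrA [defect _ _ _ _ _ * _]mulrC Y; ring.
have L1 : (fun n => qpoch (q ^+ 2) (q ^+ 2 * c ^+ 2) n * defect C q b c t) @ \oo -->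
    qpoch_inf (q ^+ 2) (q ^+ 2 * c ^+ 2) * defect C q b c t.
  by apply: cvgM; [exact: qpoch_cvg | exact: cvg_cst].
have L2 : (fun n => qpoch q (b * c) n * qpoch q (- (q ^+ 2 * c * t ^+ 2)) n
   * defect C q b (c * q ^+ n) t) @ \oo --> qpoch_inf q (b * c)
     * qpoch_inf q (- (q ^+ 2 * c * t ^+ 2)) * 0.
  by apply: cvgM; [apply: cvgM; exact: qpoch_cvg | exact: defect_cvg0].
have E := cvg_lim (@norm_hausdorff _ _) L1.
rewrite (_ : (fun n => _) = (fun n =>
  qpoch q (b * c) n * qpoch q (- (q ^+ 2 * c * t ^+ 2)) n
   * defect C q b (c * q ^+ n) t)) in E; last exact/funext.
rewrite (cvg_lim (@norm_hausdorff _ _) L2) mulr0 in E.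
have nonzero : qpoch_inf (q ^+ 2) (q ^+ 2 * c ^+ 2) != 0.
  (* The factors 1 - q^2 c^2 q^(2i) are those of q c^2 at the odd exponents 2i + 1. *)
  apply: qpoch_inf_neq0 => // i; have [_ + _] := Hg (i + i).+1; congr (_ != _).
  by rewrite exprAC [q ^+ (i + i).+1]exprS exprD; ring.
by apply: (mulfI nonzero); rewrite mulr0; exact: (esym (E _)).
Qed.

(** * Return to the hypergeometric series *)

(** The chosen square roots occur only in parameters paired with their opposites, so merging each
    pair into base q^2 eliminates them. *)
Lemma qpoch_pm (C : numFieldType) (q y : C) n :
  qpoch q y n * qpoch q (- y) n = qpoch (q ^+ 2) (y ^+ 2) n.
Proof.
rewrite /qpoch -big_split /=; apply: eq_bigr => i _; rewrite exprAC; ring.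
Qed.

Lemma qpoch_inf_pm (C : numFieldType) (hC : geo_complete C) (q y : C) :
  `|q| < 1 -> qpoch_inf (q ^+ 2) (y ^+ 2) = qpoch_inf q y * qpoch_inf q (- y).
Proof.
move=> q1; apply: cvg_lim; first exact: norm_hausdorff.
rewrite (_ : qpoch _ _ = fun n => qpoch q y n * qpoch q (- y) n); last first.
  by apply/funext => n; rewrite qpoch_pm.
by apply: cvgM; exact: qpoch_cvg.
Qed.

(** Factors are sorted by the parity of their exponent. For x = q (a t)^2 the second product is (q a
    t; q)_oo (- q a t; q)_oo, whose first factor cancels in the prefactor. *)
Lemma qpoch_inf_bisect (C : numFieldType) (hC : geo_complete C) (q x : C) :
  `|q| < 1 -> qpoch_inf q x = qpoch_inf (q ^+ 2) x * qpoch_inf (q ^+ 2) (x * q).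
Proof.
move=> q1; have q21 : `|q ^+ 2| < 1 by rewrite normrX exprn_ilt1.
have L1 : (fun n => qpoch (q ^+ 2) x n * qpoch (q ^+ 2) (x * q) n) @ \oo -->
  qpoch_inf (q ^+ 2) x * qpoch_inf (q ^+ 2) (x * q).
  by apply: cvgM; exact: qpoch_cvg.
have L2 : (fun n => qpoch q x (n + n)%N) @ \oo --> qpoch_inf q x.
  apply: (@cvg_comp _ _ _ (fun n => n + n)%N (qpoch q x)); last exact: qpoch_cvg.
  by apply/cvgnyPge => A; exists A => // n /= An; exact: leq_trans (leq_addr _ _).
rewrite -(cvg_lim (@norm_hausdorff _ _) L1) -(cvg_lim (@norm_hausdorff _ _) L2).
congr (limn _); apply/funext; elim => [|n IH]; first by rewrite !qpoch0 mulr1.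
by rewrite addnS addSn !qpochSr IH (exprAC q 2) [q ^+ (n + n).+1]exprS exprD; ring.
Qed.

Lemma qhyp_lhs (C : numFieldType) (q b c t : C) : b != 0 ->
  qhyp [:: b * c; b] (lhs_lower q (b * c) b) q (q * t ^+ 2) = lhs_series C q b c t.
Proof.
move=> b0; rewrite /qhyp /lhs_series; congr (limn (series _)); apply/funext => k.
rewrite /qhyp_term /qpochs !big_cons !big_nil /= expr0z !mulr1 /lcoef.
by rewrite (_ : q * (b * c) / b = q * c) //; field.
Qed.

Lemma denominators_admissible (C : numFieldType) (q b c t sq sb st : C) :
  b != 0 -> sb ^+ 2 = b -> st ^+ 2 = t ->
  denominators_neq0 q (b * c) b t sq sb st -> admissible C q b c t.
Proof.
move=> b0 hsb hst [D1 [D2 D3]] n; split.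
- have /D1/(_ n) : q * (b * c) * b^-1 \in q :: lhs_lower q (b
  * c) b by rewrite !inE eqxx orbT.
  by congr (_ != _); field.
- have /D3/(_ n) : q * (b * c) ^+ 2 * b^-2 \in q :: rhs_lower q (b
  * c) b t sq sb st.
    by rewrite !inE eqxx ?orbT.
  by congr (_ != _); field.
(* The symbol in q a^2 b^-1 t starts at exponent 1. The factor at exponent 0 is (1 - s)(1 + s), made
   of the first factors of two lower parameters, since s^2 = a^2 b^-1 t. *)
- case: n => [|n].
    pose s := b * c * sb^-1 * st.
    have /D3/(_ 0%N) h1 : s \in q :: rhs_lower q (b
      * c) b t sq sb st by rewrite !inE eqxx ?orbT.
    have /D3/(_ 0%N) h2 : - s \in q :: rhs_lower q (b
      * c) b t sq sb st by rewrite !inE eqxx ?orbT.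
    have sb0 : sb != 0 by apply: contraNneq b0 => z; rewrite -hsb z expr0n.
    have -> : 1 - b * c ^+ 2 * t * q ^+ 0 = (1 - s * q ^+ 0) * (1 - - s * q ^+ 0).
      by rewrite /s !expr0 !mulr1 -hsb -hst; field.
    exact: mulf_neq0.
  have /D2/(_ n) : q * (b * c) ^+ 2 * b^-1 * t \in prefactor_den q (b * c) b t.
    by rewrite !inE eqxx ?orbT.
  by congr (_ != _); rewrite [q ^+ n.+1]exprS; field.
Qed.

Lemma qhyp_term_rhs (C : numFieldType) (hC : geo_complete C) (q b c t sq sb st :
  C) k :
  `|q| < 1 -> `|t| < 1 -> b != 0 ->
  sq ^+ 2 = q -> sb ^+ 2 = b -> st ^+ 2 = t ->
  denominators_neq0 q (b * c) b t sq sb st ->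
  qpochs_inf q (prefactor_num q (b * c) b t) / qpochs_inf q (prefactor_den q (b
    * c) b t)
  * qhyp_term (rhs_upper q (b * c) b t sq sb st) (rhs_lower q (b
    * c) b t sq sb st) q (q * t) k
  = rhs_scale C q t * (rcoef C q b c t k * (q * t) ^+ k).
Proof.
move=> q1 t1 b0 hsq hsb hst D.
have Hg := denominators_admissible C q b c t sq sb st b0 hsb hst D.
case: D => [_ [D2 D3]].
have q21 : `|q ^+ 2| < 1 by rewrite normrX exprn_ilt1.
have sb0 : sb != 0 by apply: contraNneq b0 => z; rewrite -hsb z expr0n.
have t21 : `|q * t ^+ 2| < 1 by rewrite expr2 !normM_lt1.
pose A := b * c ^+ 2 * t; pose s := b * c * sb^-1 * st; pose y := sq * (b * c) * t.
have s2 : s ^+ 2 = A by rewrite /s /A -hsb -hst; field.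
have y2 : y ^+ 2 = q * (b * c * t) ^+ 2 by rewrite /y -hsq; ring.
have in3 x : x \in rhs_lower q (b * c) b t sq sb st -> forall n,
  1 - x * q ^+ n != 0.
  by move=> xi; apply: D3; rewrite inE xi orbT.
have ns : qpoch (q ^+ 2) A k != 0.
  rewrite -s2 -qpoch_pm mulf_neq0 // qpoch_neq0 //; apply: in3;
    rewrite !inE eqxx ?orbT //.
have ny : qpoch (q ^+ 2) (q * (b * c * t) ^+ 2) k != 0.
  rewrite -y2 -qpoch_pm mulf_neq0 // qpoch_neq0 //; apply: in3;
    rewrite !inE eqxx ?orbT //.
have nat_ : qpoch q (- (q * (b * c) * t)) k != 0.
  by apply: qpoch_neq0; apply: in3; rewrite !inE eqxx ?orbT.
have nct : qpoch q (q * c * t) k != 0.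
  apply: qpoch_neq0; rewrite (_ : q * c * t = q * (b * c) * b^-1 * t);
    last by field.
  by apply: in3; rewrite !inE eqxx ?orbT.
have nc2 : qpoch q (q * c ^+ 2) k != 0 by apply: qpoch_neq0 => i; have [] := Hg i.
have nq : qpoch q q k != 0 by apply: qpoch_neq0 => i; exact: one_subXS_neq0.
have niq : qpoch_inf q (q * (b * c) * t) != 0.
  by apply: qpoch_inf_neq0 => //; apply: D2; rewrite !inE eqxx ?orbT.
have niA : qpoch_inf q (A * q ^+ k) != 0.
  apply: qpoch_inf_neq0 => // i; have [_ _] := Hg (k + i)%N; congr (_ != _).
  by rewrite /A exprD; ring.
have nA : qpoch q A k != 0 by apply: qpoch_neq0 => i; have [] := Hg i.
have nt2 : qpoch_inf q (q * t ^+ 2) != 0.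
  by apply: qpoch_inf_neq0 => // i; exact: one_subMX_neq0.
have A1 : 1 - A != 0 by have [_ _] := Hg 0%N; rewrite expr0 mulr1.
(* This is the very-well-poised quotient: the pairs of q s and s leave (1 - A q^(2k)) / (1 - A). *)
have vwp : qpoch (q ^+ 2) (A * q ^+ 2) k = qpoch (q ^+ 2) A k * (1 - A
  * (q ^+ k) ^+ 2) / (1 - A).
  by rewrite exprAC -qpochSr qpochSl [RHS]mulrC mulKf.
(* Written this way, the prefactor cancels both (A; q)_k and the denominator 1 - A of the series. *)
have iA : qpoch_inf q (q * A) = qpoch q A k * qpoch_inf q (A * q ^+ k) / (1 - A).
  by rewrite -(qpoch_infD C hC) // (qpoch_infS C hC q A) // [RHS]mulrC mulKf //
    [A * q]mulrC.
rewrite /qhyp_term /qpochs_inf /qpochs !big_cons !big_nil /= expr0z !mulr1.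
rewrite (_ : (b * c) ^+ 2 * b^-1 * t = A); last by rewrite /A; field.
rewrite (_ : q * (b * c) ^+ 2 * b^-1 * t = q * A); last by rewrite /A; field.
rewrite (_ : q * (b * c) * sb^-1 * st = q * s); last by rewrite /s; ring.
rewrite (_ : sq * (b * c) * b^-1 = sq * c); last by field.
rewrite (_ : b * c * b^-1 = c); last by field.
rewrite (_ : q * (b * c) ^+ 2 * b^-2 = q * c ^+ 2); last by field.
rewrite (_ : q * (b * c) * b^-1 * t = q * c * t); last by field.
rewrite -/s -/y iA.
transitivity (qpoch_inf q (q * (b * c * t) ^+ 2) * qpoch_inf q (q * c * t)
  * qpoch_inf q (q * t)
  / (qpoch q A k * qpoch_inf q (A * q ^+ k) / (1 - A) * qpoch_inf q (q * (b
    * c) * t) * qpoch_inf q (q * t ^+ 2))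
  * ((qpoch q A k * (qpoch q (q * s) k * qpoch q (- (q * s)) k) * (qpoch q (sq
    * c) k * qpoch q (- (sq * c)) k)
     * qpoch q (- c) k * qpoch q (b * t) k * qpoch q (b * c) k)
   / (qpoch q q k * (qpoch q s k * qpoch q (- s) k) * (qpoch q y k
     * qpoch q (- y) k) * qpoch q (q * c ^+ 2) k
      * qpoch q (q * c * t) k * qpoch q (- (q * (b * c) * t)) k) * (q * t) ^+ k)).
  by congr (_ / _ * (_ / _ * _)); ring.
rewrite !qpoch_pm s2 y2.
rewrite (_ : (q * s) ^+ 2 = A * q ^+ 2); last by rewrite -s2; ring.
rewrite (_ : (sq * c) ^+ 2 = q * c ^+ 2); last by rewrite -hsq; ring.
rewrite vwp (qpoch_inf_bisect C hC q) //.
rewrite (_ : q * (b * c * t) ^+ 2 * q = (q * (b * c) * t) ^+ 2); last by ring.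
rewrite (qpoch_inf_pm C hC) //.
(* Splitting these infinite products at k releases finite symbols that cancel the lower parameters
   in a t, - q a t and q a b^-1 t. *)
rewrite (qpoch_infD C hC (q ^+ 2) (q * (b * c * t) ^+ 2) k) //.
rewrite (qpoch_infD C hC q (- (q * (b * c) * t)) k) //.
rewrite (qpoch_infD C hC q (q * c * t) k) //.
rewrite /rhs_scale /rcoef.
rewrite (_ : q * (b * c * t) ^+ 2 * q ^+ 2 ^+ k = q * (b * c * t * q ^+ k) ^+ 2);
  last by rewrite exprAC; ring.
rewrite (_ : - (q * (b * c) * t) * q ^+ k = - (q * (b * c * t * q ^+ k)));
  last by ring.
rewrite -/A.
move: ns ny nat_ nct nc2 nq niq niA nA nt2 A1.
move: (qpoch_inf q (q * t)) (qpoch_inf q (q * t ^+ 2)) (qpoch_inf q (q * c * t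
  * _)) (qpoch_inf q (A * _))
  (qpoch_inf q (q * (b * c) * t)) (qpoch_inf (q ^+ 2) _) (qpoch_inf q (- _)).
move: (qpoch q q k) (qpoch q A k) (qpoch q (q * c * t) k) (qpoch q (q
  * c ^+ 2) k) (qpoch (q ^+ 2) A k)
  (qpoch (q ^+ 2) (q * c ^+ 2) k) (qpoch (q ^+ 2) (q
    * _ ^+ 2) k) (qpoch q (- c) k) (qpoch q (b * t) k) (qpoch q (b * c) k)
  (qpoch q (- _) k).
move: ((q * t) ^+ k) (q ^+ k) => Z X p1 p2 p3 p4 p5 p6 p7 p8 p9 p10 p11 i1 i2 i3
  i4 i5 i6 i7.
move=> h1 h2 h3 h4 h5 h6 h7 h8 h9 h10 h11.
field; nonzero.
Qed.

(** The symbol in q (a t)^2 factors into those of the pairs q^(1/2) a t and q a t with both signs,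
    all of which occur in denominators; q a b^-1 t is a lower parameter, and |q t| < 1 settles the
    last one. *)
Lemma prefactor_neq0 (C : numFieldType) (hC : geo_complete C) (q b c t sq sb st :
  C) :
  `|q| < 1 -> `|t| < 1 -> b != 0 -> sq ^+ 2 = q ->
  denominators_neq0 q (b * c) b t sq sb st ->
  qpochs_inf q (prefactor_num q (b * c) b t) / qpochs_inf q (prefactor_den q (b
    * c) b t) != 0.
Proof.
move=> q1 t1 b0 hsq [_ [D2 D3]].
have low x : x \in rhs_lower q (b * c) b t sq sb st -> qpoch_inf q x != 0.
  by move=> xi; apply: qpoch_inf_neq0 => //; apply: D3; rewrite inE xi orbT.
have den x : x \in prefactor_den q (b * c) b t -> qpoch_inf q x != 0.
  by move=> xi; apply: qpoch_inf_neq0 => //; exact: D2.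
rewrite /qpochs_inf !big_cons !big_nil !mulr1 mulf_neq0 ?invr_neq0 // !mulf_neq0 //.
- rewrite (qpoch_inf_bisect C hC) //.
  rewrite (_ : q * (b * c * t) ^+ 2 * q = (q * (b * c) * t) ^+ 2); last by ring.
  rewrite (_ : q * (b * c * t) ^+ 2 = (sq * (b * c) * t) ^+ 2);
    last by rewrite -hsq; ring.
  rewrite !(qpoch_inf_pm C hC) //; apply: mulf_neq0; apply: mulf_neq0.
  + by apply: low; rewrite !inE eqxx ?orbT.
  + by apply: low; rewrite !inE eqxx ?orbT.
  + by apply: den; rewrite !inE eqxx ?orbT.
  + by apply: low; rewrite !inE eqxx ?orbT.
- by apply: low; rewrite !inE eqxx ?orbT.
- by apply: qpoch_inf_neq0 => // i; apply: one_subMX_neq0 => //; exact: normM_lt1.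
- by apply: den; rewrite !inE eqxx ?orbT.
- by apply: den; rewrite !inE eqxx ?orbT.
- by apply: den; rewrite !inE eqxx ?orbT.
Qed.

Lemma quadratic_identity_holds (C : numFieldType) (hC : geo_complete C) (q a b t
  sq sb st : C) :
  `|q| < 1 -> q != 0 -> `|t| < 1 -> b != 0 ->
  sq ^+ 2 = q -> sb ^+ 2 = b -> st ^+ 2 = t ->
  denominators_neq0 q a b t sq sb st -> quadratic_identity q a b t sq sb st.
Proof.
move=> q1 q0 t1 b0 hsq hsb hst.
have [c ->] : exists c, a = b * c by exists (a / b); field.
move=> D; have Hg := denominators_admissible C q b c t sq sb st b0 hsb hst D.
rewrite /quadratic_identity qhyp_lhs //.
have /eqP := defect_eq0 C hC q b c t q1 q0 t1 Hg; rewrite subr_eq0 => /eqP ->.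
set P := _ / _.
have HP k := qhyp_term_rhs C hC q b c t sq sb st k q1 t1 b0 hsq hsb hst D.
have P0 : P != 0 by exact: (prefactor_neq0 C hC q b c t sq sb st).
(* Division by P expresses each term of the series through [rcoef], so its sum is read off from a
   series already known to converge. *)
have -> : qhyp (rhs_upper q (b * c) b t sq sb st) (rhs_lower q (b
  * c) b t sq sb st) q (q * t)
    = rhs_scale C q t / P * rhs_series C q b c t.
  rewrite /qhyp /rhs_series -limn_seriesM; last exact: is_cvg_rhs_series.
  congr (limn (series _)); apply/funext => k.
  by apply: (mulfI P0); rewrite HP [RHS]mulrA [P * _]mulrC divfK.
by rewrite [RHS]mulrA [P * _]mulrC divfK.
Qed.

Theorem theorem9 (R : realType) (t : R) (q a b : R[i]) :
  -1 < t -> t < 1 -> 0 < `|q| -> `|q| < 1 -> b != 0 ->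
  (forall sq sb st : R[i], sq ^+ 2 = q -> sb ^+ 2 = b -> st ^+ 2 = t%:C ->
     denominators_neq0 q a b t%:C sq sb st ->
     quadratic_identity q a b t%:C sq sb st) /\
  (forall sq sb st : R[i], sq ^+ 2 = q -> sb ^+ 2 = b -> st ^+ 2 = (- t)%:C ->
     denominators_neq0 q a b (- t)%:C sq sb st ->
     quadratic_identity q a b (- t)%:C sq sb st).
Proof.
move=> tm1 t1 q0 q1 b0; rewrite normr_gt0 in q0.
have norm_lt1 (u : R) : -1 < u -> u < 1 -> `|u%:C| < 1 :> R[i].
  by move=> u0 u1; rewrite normc_def /= expr0n addr0 sqrtr_sqr -(rmorph1
    (@real_complex R)) ltcR ltr_norml u0.
split=> sq sb st hsq hsb hst D.
- apply: (quadratic_identity_holds _ (@complex_geo_complete R)) => //.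
  exact: norm_lt1.
- apply: (quadratic_identity_holds _ (@complex_geo_complete R)) => //.
  by apply: norm_lt1; [rewrite ltrN2 | rewrite ltrNl].
Qed.
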